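(* The Koszul dual of a generic quadratic algebra need not be generic. More precisely: (a) there exist a field $k$ and a generic commutative quadratic $k$-algebra $A$ such that $A^!$ is not generic as an algebra of Lie type; (b) there exist a field $k$ and a generic non-commutative quadratic $k$-algebra $A$ such that $A^!$ is not generic as a non-commutative algebra; (c) there exist a field $k$ and a generic quadratic $k$-algebra $A$ of Lie type such that $A^!$ is not generic as a commutative algebra.
   Context: $k$ is a field with prime field $k_0$; it is a standing assumption that $k$ has sufficiently high transcendence degree over $k_0$ (at least the number of indeterminates in $c$ below). Algebras are graded, $A=\bigoplus_{i\ge0}A_i$, $A_0=k$, generated by the finite-dimensional space $A_1$; $A(z)=\sum_i\dim(A_i)z^i$. Quadratic algebras of type $(n,r)$. Commutative: $k[x_1,\ldots,x_n]/(f_1,\ldots,f_r)$ with $f_1,\ldots,f_r$ linearly independent quadratic forms. Non-commutative: $k\langle x_1,\ldots,x_n\rangle/(f_1,\ldots,f_r)$ with $f_1,\ldots,f_r$ linearly independent quadratic forms in the free associative algebra. Lie type: $k\langle x_1,\ldots,x_n\rangle/(f_1,\ldots,f_r)$ with $f_1,\ldots,f_r$ linearly independent elements of the form $f_i=\sum_{j}c_{i,j}x_j^2+\sum_{j<l}c_{i,j,l}(x_jx_l+x_lx_j)$, $c_{i,j},c_{i,j,l}\in k$. In each class, for $t=(n,r)$, let $A_t$ be the algebra of that class over the field $k_0(c)$ defined by $r$ relations whose coefficients (with respect to the commutative monomials of degree 2; the non-commutative monomials of degree 2; the elements $x_j^2$ and $x_jx_l+x_lx_j$, $j<l$, respectively)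 are distinct indeterminates, $c$ being the set of all these indeterminates. An algebra $A$ of type $(n,r)$ in one of the classes is generic (in that class) if $A(z)=A_t(z)$. Koszul dual: a quadratic algebra (commutative ones being regarded as quotients of the free algebra, the commutators being included among the relations) can be written $A=T(V)/\langle U\rangle$ with $U\subseteq V\otimes V$; then $A^!=T(V^* )/\langle U^0\rangle$ with $U^0=\{f\in V^*\otimes V^*:\ f(U)=0\}$. The Koszul dual of a commutative quadratic algebra of type $(n,r)$ is of Lie type $(n,\binom{n+1}{2}-r)$ and conversely, and the Koszul dual of a non-commutative algebra of type $(n,r)$ has type $(n,n^2-r)$. *)

(* Defs.v *)
From HB Require Import structures.
From mathcomp Require Import all_boot all_order all_algebra.
From mathcomp Require Import monalg.
From mathcomp Require Import mpoly.

Set Implicit Arguments.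
Unset Strict Implicit.
Unset Printing Implicit Defensive.

Import GRing.Theory.
Local Open Scope ring_scope.

(* [monalg] attaches this notation to its own type of commutative polynomials;
   here it denotes the polynomial ring of the file [mpoly]. *)
Notation "{ 'mpoly' T [ n ] }" := (mpoly.mpoly n T) : type_scope.

Definition is_prime_field (k0 : fieldType) : Prop :=
  forall x : k0, exists a b : int, b%:~R != 0 :> k0 /\ x = a%:~R / b%:~R.

(* The transcendence degree of k over k0 is at least N: there are N elements
   of k that are algebraically independent over k0. *)
Definition trdeg_ge (k0 k : fieldType) (iota : {rmorphism k0 -> k}) (N : nat)
    : Prop :=
  exists a : 'I_N -> k, forall p : {mpoly k0[N]}, mpoly.mmap iota a p = 0 -> p = 0.

(* With V = <x_1, ..., x_n>, the tensor algebra T(V) is the free algebra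
   k<x_1, ..., x_n>, i.e. the algebra of the free monoid on 'I_n. The space
   V (x) V is represented by 'M[k]_n: the matrix M stands for the quadratic
   form \sum_(i, j) M i j x_i x_j. A quadratic algebra T(V)/<U> is given by its
   space of relations U : {vspace 'M[k]_n}. *)
Section QuadraticAlgebra.
Variables (k : fieldType) (n : nat).

Definition freeAlg := {malg k[{fmonom 'I_n}]}.

Definition gen (i : 'I_n) : freeAlg := monalg.mkmalgU (fmu i) 1.

Definition qform (M : 'M[k]_n) : freeAlg :=
  \sum_(i < n) \sum_(j < n) M i j *: (gen i * gen j).

Definition homogeneous (d : nat) (f : freeAlg) : Prop :=
  forall m : {fmonom 'I_n}, monalg.mcoeff m f != 0 -> fdeg m = d.

(* Membership in the two-sided ideal <U> of T(V). *)
Definition in_ideal (U : {vspace 'M[k]_n}) (f : freeAlg) : Prop :=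
  exists2 s : seq (freeAlg * 'M[k]_n * freeAlg),
    forall t, t \in s -> t.1.2 \in U
    & f = \sum_(t <- s) t.1.1 * qform t.1.2 * t.2.

(* dim A_d = m for A = T(V)/<U>: there are m forms of degree d whose classes
   modulo <U> are a basis of the component A_d. *)
Definition has_dim (U : {vspace 'M[k]_n}) (d m : nat) : Prop :=
  exists e : 'I_m -> freeAlg,
    [/\ forall i, homogeneous d (e i),
        forall c : 'I_m -> k,
          in_ideal U (\sum_(i < m) c i *: e i) -> forall i, c i = 0
      & forall f, homogeneous d f ->
          exists c : 'I_m -> k, in_ideal U (f - \sum_(i < m) c i *: e i)].

(* V^* (x) V^* is again represented by 'M[k]_n, via the dual basis of
   x_1, ..., x_n. *)
Definition pairing (A B : 'M[k]_n) : k^o :=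
  \sum_(i < n) \sum_(j < n) A i j * B i j.

Fact pairing_is_linear (A : 'M[k]_n) : linear (pairing A).
Proof.
move=> a B C; rewrite /pairing scaler_sumr -big_split; apply: eq_bigr => i _.
rewrite scaler_sumr -big_split; apply: eq_bigr => j _.
by rewrite !mxE mulrDr mulrCA.
Qed.

HB.instance Definition _ (A : 'M[k]_n) :=
  GRing.isLinear.Build k 'M[k]_n k^o _ (pairing A) (pairing_is_linear A).

(* The space U^0 of relations of the Koszul dual T(V^* )/<U^0>. *)
Definition koszul_dual (U : {vspace 'M[k]_n}) : {vspace 'M[k]_n} :=
  (\bigcap_(A <- vbasis U) lker (linfun (pairing A)))%VS.

Lemma koszul_dualP (U : {vspace 'M[k]_n}) (B : 'M[k]_n) :
  reflect (forall A, A \in U -> pairing A B = 0) (B \in koszul_dual U).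
Proof.
have pairingC A C : pairing A C = pairing C A.
  by apply: eq_bigr => i _; apply: eq_bigr => j _; rewrite mulrC.
have memP (s : seq 'M[k]_n) :
    reflect (forall A, A \in s -> pairing A B = 0)
            (B \in (\bigcap_(A <- s) lker (linfun (pairing A)))%VS).
  elim: s => [|A s IHs]; first by rewrite big_nil memvf; apply: ReflectT.
  rewrite big_cons memv_cap memv_ker lfunE.
  apply: (iffP andP) => [[/eqP A0 /IHs s0] C|s0].
    by rewrite inE => /predU1P[->|/s0].
  split; first by apply/eqP/s0; rewrite mem_head.
  by apply/IHs => C Cs; apply: s0; rewrite inE Cs orbT.
apply: (iffP (memP _)) => U0 A AU; last exact/U0/vbasis_mem.
rewrite (coord_vbasis AU) pairingC linear_sum big1 // => i _.
by rewrite linearZ /= pairingC U0 ?scaler0 // memt_nth.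
Qed.

End QuadraticAlgebra.

Definition same_series (k k' : fieldType) (n n' : nat)
    (U : {vspace 'M[k]_n}) (U' : {vspace 'M[k']_n'}) : Prop :=
  forall d, exists m, has_dim U d m /\ has_dim U' d m.

Variant qclass := Commutative | NonCommutative | LieType.

(* Indices of the degree 2 "monomials" with respect to which the relations of
   the given class are expanded: pairs (j, l), with j <= l in the commutative
   and Lie classes. *)
Definition admissible (C : qclass) (n : nat) (p : 'I_n * 'I_n) : bool :=
  if C is NonCommutative then true else (p.1 <= p.2)%N.

Definition mon2 (C : qclass) (n : nat) := {p : 'I_n * 'I_n | admissible C p}.

Section Classes.
Variables (k : fieldType) (C : qclass) (n : nat).

(* x_j x_l in the first two classes (for commutative algebras, a lift to T(V)
   of the commutative monomial); x_j ^ 2 or x_j x_l + x_l x_j in the last. *)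
Definition mon2_form (p : 'I_n * 'I_n) : 'M[k]_n :=
  if C is LieType then
    if p.1 == p.2 then delta_mx p.1 p.1
    else delta_mx p.1 p.2 + delta_mx p.2 p.1
  else delta_mx p.1 p.2.

(* Commutative algebras are quotients of T(V) by relations among which are the
   commutators; the other classes have no predefined relation. *)
Definition built_in : {vspace 'M[k]_n} :=
  if C is Commutative then
    <<[seq delta_mx p.1 p.2 - delta_mx p.2 p.1 | p : 'I_n * 'I_n]>>%VS
  else 0%VS.

Definition relations (r : nat) (c : 'I_r -> mon2 C n -> k) : seq 'M[k]_n :=
  [seq \sum_(p : mon2 C n) c i p *: mon2_form (val p) | i : 'I_r].

Definition rel_space (r : nat) (c : 'I_r -> mon2 C n -> k)
    : {vspace 'M[k]_n} :=
  (<<relations c>> + built_in)%VS.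

Definition of_type (r : nat) (U : {vspace 'M[k]_n}) : Prop :=
  exists c : 'I_r -> mon2 C n -> k, free (relations c) /\ U = rel_space c.

End Classes.

Definition num_coef (C : qclass) (n r : nat) : nat := #|{: ('I_r * mon2 C n)%type}|.

Definition field_of_coef (k0 : fieldType) (C : qclass) (n r : nat) : fieldType :=
  {fraction {mpoly k0[num_coef C n r]}}.

Definition indet_coef (k0 : fieldType) (C : qclass) (n r : nat)
    (i : 'I_r) (p : mon2 C n) : field_of_coef k0 C n r :=
  FracField.tofrac ('X_(enum_rank (i, p)) : {mpoly k0[num_coef C n r]}).

(* The relations of the algebra A_t, t = (n, r), over k0(c). *)
Definition generic_rel (k0 : fieldType) (C : qclass) (n r : nat)
    : {vspace 'M[field_of_coef k0 C n r]_n} :=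
  rel_space (@indet_coef k0 C n r).

(* T(V)/<U> is of type (n, r) in the class C and generic in that class; k0 is
   the prime field of k. *)
Definition generic (k0 k : fieldType) (C : qclass) (n r : nat)
    (U : {vspace 'M[k]_n}) : Prop :=
  of_type C r U /\ same_series U (generic_rel k0 C n r).

(* A field k with prime field k0 and a generic algebra T(V)/<U> over k, of type
   (n, r) in the class C, whose Koszul dual is of type (n, s) in the class C'
   but is not generic in that class. The transcendence degree of k is large
   enough for both types. *)
Definition nongeneric_dual (k0 k : fieldType) (iota : {rmorphism k0 -> k})
    (C C' : qclass) (n r s : nat) (U : {vspace 'M[k]_n}) : Prop :=
  [/\ is_prime_field k0,
      trdeg_ge iota (num_coef C n r) /\ trdeg_ge iota (num_coef C' n s),
      generic k0 C r U,
      of_type C' s (koszul_dual U)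
    & ~ generic k0 C' s (koszul_dual U)].

(* Main.v *)
From HB Require Import structures.
Require Import Defs.
From mathcomp Require Import all_boot all_order all_algebra.
From mathcomp Require Import zify ring.
From mathcomp Require Import finmap.
From mathcomp Require Import monalg.
From mathcomp Require Import mpoly.

(* The prime field is 'F_2, so that [x, y] = x y + y x and signs disappear.

   In (a) and (b) the dual L = A^! is k<x_0, ..., x_3> modulo [x_0, x_1],
   [x_0, x_2], [x_1, x_3], x_2^2 + x_3^2. Here A has series 1 + 4z + 4z^2, that
   is, A_3 = 0. By semicontinuity (a rank over k_0(c) is at least the rank of any
   specialization) this makes A generic, both as a commutative and as a
   non-commutative algebra. The ideal of an algebra with 4 relations R in 4
   variables is R V V + V R V + V V R in degree 4, where R R lies in
   R V V and in V V R; for L a Jacobi identity gives one more dependency, hence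
   dim L_4 >= 81. However k<x_0, x_1> (x) k<x_2, x_3>, whose relations are
   [x_i, x_j] for i < 2 <= j, has dimension 80 in degree 4, so generic algebras
   have dimension at most 80 there.

   In (c), A = k<x, y, z>/(x^2 + [x, y], y^2 + [y, z], z^2 + [z, x]). Squares are
   central in A, so A is spanned by the x^a y^b z^c, while over the generic
   point the relations express the [x_i, x_j] by squares, and then the x^a y^b z^c
   are independent because the algebra acts on k[x, y, z] by differential
   operators. Hence A(z) = A_t(z) = (1 - z)^-3. The dual is commutative, and its
   relations have the common zero (1, 1, 1), so it is nonzero in degree 4; but a
   generic commutative algebra of type (3, 3), like k[x, y, z]/(x^2, y^2, z^2),
   vanishes there. *)

Set Implicit Arguments.
Unset Strict Implicit.
Unset Printing Implicit Defensive.

Import GRing.Theory.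
Local Open Scope ring_scope.

(** * Words and ideals *)

Section RingSums.
Variable R : nzRingType.

Lemma mul_sums (I J : Type) (r : seq I) (s : seq J) (F : I -> R) (G : J -> R) x :
  (\sum_(i <- r) F i) * x * (\sum_(j <- s) G j) =
  \sum_(i <- r) \sum_(j <- s) F i * x * G j.
Proof. by rewrite !mulr_suml; apply: eq_bigr => i _; rewrite mulr_sumr. Qed.

Lemma mul_sum_mul (I : Type) (r : seq I) (F G H : I -> R) x y :
  x * (\sum_(i <- r) F i * G i * H i) * y =
  \sum_(i <- r) (x * F i) * G i * (H i * y).
Proof. by rewrite mulr_sumr mulr_suml; apply: eq_bigr => i _; rewrite !mulrA. Qed.

End RingSums.

Section Words.
Variables (k : fieldType) (n : nat).
Local Notation freeAlg := (freeAlg k n).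
Implicit Types (U : {vspace 'M[k]_n}) (f g : freeAlg) (u v w : seq 'I_n).

(* Locked, because unification would otherwise unfold words into finitely
   supported functions. *)
Definition word : seq 'I_n -> freeAlg :=
  locked (fun w => monalg.mkmalgU (FMonom w) 1).

Lemma word_def w : word w = monalg.mkmalgU (FMonom w) 1.
Proof. by rewrite /word -lock. Qed.

Lemma word_cat u w : word (u ++ w) = word u * word w.
Proof. rewrite !word_def malgM_def fgmulUU mul1r; congr (monalg.mkmalgU _ _).
by apply/val_inj; rewrite /= fmM. Qed.

Lemma gen_word i : gen k i = word [:: i].
Proof. by rewrite /gen fmuE word_def. Qed.

Lemma word_cons i w : word (i :: w) = gen k i * word w.
Proof. by rewrite gen_word -word_cat. Qed.

Lemma mcoeff_word v w : monalg.mcoeff (FMonom v) (word w) = (v == w)%:R.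
Proof. by rewrite word_def mcoeffU1 -val_eqE /= eq_sym. Qed.

Lemma wordE f :
  f = \sum_(v <- monalg.msupp f) monalg.mcoeff v f *: word v.
Proof.
rewrite {1}[f]monalgE; apply: eq_bigr => v _; apply/malgP => w.
by rewrite monalg.mcoeffZ mcoeffU word_def mcoeffU1 fmK mulr_natr.
Qed.

(** Multiples of the empty word are central because [k] is commutative, so scalars also pass through
    a left factor. *)
Lemma freeAlg_scaleAr a f g : f * (a *: g) = a *: (f * g).
Proof.
have mulC (h : freeAlg) : h * (monalg.mkmalgU mone a : freeAlg) =
      (monalg.mkmalgU mone a : freeAlg) * h.
  rewrite !malgM_def fgmulUg fgmulgU; apply: eq_bigr => m _.
  by rewrite mulrC mul1m mulm1.
by rewrite -!mul_malgC mulrA mulC mulrA.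
Qed.

Lemma freeAlg_scaleAl a f g : (a *: f) * g = a *: (f * g).
Proof. by rewrite scalerAl. Qed.

(** Expanding the outer factors shows that [<U>] is spanned by the products of a relation with a
    word on each side; these become the rows of [ideal_mx]. *)
Lemma mul_wordE f g h :
  f * g * h = \sum_(u <- monalg.msupp f) \sum_(w <- monalg.msupp h)
    (monalg.mcoeff u f * monalg.mcoeff w h) *: (word u * g * word w).
Proof.
rewrite {1}(wordE f) {1}(wordE h) [LHS]mul_sums; apply: eq_bigr => u _.
by apply: eq_bigr => w _; rewrite [LHS]freeAlg_scaleAr !freeAlg_scaleAl scalerA mulrC.
Qed.

Lemma homogeneous_word w : homogeneous (size w) (word w).
Proof.
by move=> [v]; rewrite mcoeff_word; case: (v =P w) => [->|] //=; rewrite eqxx.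
Qed.

Lemma homogeneous_sum d (I : Type) (s : seq I) (F : I -> freeAlg) :
  (forall i, homogeneous d (F i)) -> homogeneous d (\sum_(i <- s) F i).
Proof.
move=> hF m; apply: contra_neq_eq => dm; rewrite raddf_sum big1 // => i _.
by apply/eqP; apply: contraTT dm => /hF->; rewrite eqxx.
Qed.

Lemma homogeneousZ d a f : homogeneous d f -> homogeneous d (a *: f).
Proof.
by move=> hf m; rewrite monalg.mcoeffZ mulf_eq0 negb_or => /andP[_]; apply: hf.
Qed.

Lemma homogeneousB d f g :
  homogeneous d f -> homogeneous d g -> homogeneous d (f - g).
Proof.
move=> hf hg m; rewrite monalg.mcoeffB => fg.
have [f0|/hf//] := eqVneq (monalg.mcoeff m f) 0.
by apply: hg; apply: contra_neq fg => ->; rewrite f0 subr0.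
Qed.

Lemma ideal0 U : in_ideal U 0.
Proof. by exists [::]; rewrite ?big_nil. Qed.

Lemma idealD U f g : in_ideal U f -> in_ideal U g -> in_ideal U (f + g).
Proof.
move=> [s sU ->] [t tU ->]; exists (s ++ t); last by rewrite big_cat.
by move=> x; rewrite mem_cat => /orP[/sU|/tU].
Qed.

Lemma ideal_mul U f g h : in_ideal U g -> in_ideal U (f * g * h).
Proof.
move=> [s sU ->]; exists [seq (f * t.1.1, t.1.2, t.2 * h) | t <- s].
  by move=> x /mapP[t ts ->]; exact: sU ts.
by rewrite big_map [LHS]mul_sum_mul.
Qed.

Lemma ideal_mull U f g : in_ideal U g -> in_ideal U (f * g).
Proof. by move=> gU; rewrite -[_ * _]mulr1; apply: ideal_mul. Qed.

Lemma ideal_mulr U g h : in_ideal U g -> in_ideal U (g * h).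
Proof. by move=> gU; rewrite -[g]mul1r; apply: ideal_mul. Qed.

Lemma idealZ U a f : in_ideal U f -> in_ideal U (a *: f).
Proof. by rewrite -mul_malgC; apply: ideal_mull. Qed.

Lemma idealN U f : in_ideal U f -> in_ideal U (- f).
Proof. by rewrite -scaleN1r; apply: idealZ. Qed.

Lemma ideal_sum U (I : Type) (s : seq I) (P : pred I) (F : I -> freeAlg) :
  (forall i, P i -> in_ideal U (F i)) -> in_ideal U (\sum_(i <- s | P i) F i).
Proof. by move=> FU; elim/big_ind: _ => //; [apply: ideal0|apply: idealD]. Qed.

Lemma ideal_qform U M : M \in U -> in_ideal U (qform M).
Proof.
move=> MU; exists [:: (1, M, 1)]; first by move=> t; rewrite inE => /eqP->.
by rewrite big_seq1 /= mul1r mulr1.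
Qed.

Lemma qform_is_linear : linear (@qform k n).
Proof.
move=> a A B; rewrite /qform scaler_sumr -big_split; apply: eq_bigr => i _.
rewrite scaler_sumr -big_split; apply: eq_bigr => j _.
by rewrite !mxE scalerDl scalerA.
Qed.
HB.instance Definition _ :=
  GRing.isLinear.Build k 'M[k]_n freeAlg _ (@qform k n) qform_is_linear.

Lemma qform_delta i j : qform (delta_mx i j) = word [:: i; j].
Proof.
rewrite /qform (bigD1 i) //= [X in _ + X]big1 ?addr0 => [|i' /negPf ii'].
  rewrite (bigD1 j) //= [X in _ + X]big1 ?addr0 => [|j' /negPf jj'].
    by rewrite mxE !eqxx scale1r !gen_word -word_cat.
  by rewrite mxE jj' andbF scale0r.
by rewrite big1 // => j' _; rewrite mxE ii' scale0r.
Qed.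

(* The coefficient of v in u * qform M * w, over an arbitrary ring. *)
Definition gcoef (R : nzRingType) u w (M : 'M[R]_n) v : R :=
  \sum_a \sum_b M a b * (v == u ++ [:: a, b & w])%:R.

Lemma mcoeff_qform u w (M : 'M[k]_n) v :
  monalg.mcoeff (FMonom v) (word u * qform M * word w) = gcoef u w M v.
Proof.
rewrite /qform mulr_sumr mulr_suml raddf_sum; apply: eq_bigr => a _.
rewrite mulr_sumr mulr_suml raddf_sum; apply: eq_bigr => b _.
rewrite freeAlg_scaleAr -scalerAl /= monalg.mcoeffZ; congr (_ * _).
by rewrite !gen_word -!word_cat mcoeff_word -catA.
Qed.

End Words.

(** * Graded components as row spaces *)

Section FunctionMatrices.
Variables (k : fieldType) (W : finType).

Definition fvec (f : W -> k) : 'rV[k]_#|W| := \row_j f (enum_val j).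

Lemma fvec_inj f g : fvec f = fvec g -> f =1 g.
Proof.
by move=> /rowP fg w; have := fg (enum_rank w); rewrite !mxE enum_rankK.
Qed.

Lemma fvecK (r : 'rV[k]_#|W|) : fvec (fun w => r 0 (enum_rank w)) = r.
Proof. by apply/rowP => j; rewrite mxE enum_valK. Qed.

Lemma fvec0 : fvec (fun=> 0) = 0.
Proof. by apply/rowP => j; rewrite !mxE. Qed.

Lemma fvecZ a f : fvec (fun w => a * f w) = a *: fvec f.
Proof. by apply/rowP => j; rewrite !mxE. Qed.

Lemma fvec_sum (I : Type) (s : seq I) (P : pred I) (F : I -> W -> k) :
  fvec (fun w => \sum_(i <- s | P i) F i w) = \sum_(i <- s | P i) fvec (F i).
Proof. by apply/rowP => j; rewrite mxE summxE; apply: eq_bigr => i _; rewrite mxE. Qed.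

Lemma eq_fvec f g : f =1 g -> fvec f = fvec g.
Proof. by move=> fg; apply/rowP => j; rewrite !mxE. Qed.

Definition fmx (R : Type) (I : finType) (F : I -> W -> R) : 'M[R]_(#|I|, #|W|) :=
  \matrix_(i, j) F (enum_val i) (enum_val j).

Lemma row_fmx (I : finType) (F : I -> W -> k) i :
  row i (fmx F) = fvec (F (enum_val i)).
Proof. by apply/rowP => j; rewrite !mxE. Qed.

Lemma fvec_sub (I : finType) (F : I -> W -> k) i : (fvec (F i) <= fmx F)%MS.
Proof. by rewrite -[i]enum_rankK -row_fmx row_sub. Qed.

Lemma fmx_subP (I : finType) (F : I -> W -> k) m (A : 'M[k]_(m, #|W|)) :
  reflect (forall i, (fvec (F i) <= A)%MS) (fmx F <= A)%MS.
Proof.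
apply: (iffP row_subP) => FA i; last by rewrite row_fmx.
by rewrite -[i]enum_rankK -row_fmx.
Qed.

Lemma sub_fmxP (I : finType) (F : I -> W -> k) (r : 'rV[k]_#|W|) :
  (r <= fmx F)%MS -> exists c : I -> k, r = \sum_i c i *: fvec (F i).
Proof.
move=> /submxP[D ->]; exists (fun i => D 0 (enum_rank i)).
rewrite mulmx_sum_row (reindex enum_rank); last exact/onW_bij/enum_rank_bij.
by apply: eq_bigr => i _; rewrite row_fmx enum_rankK.
Qed.

End FunctionMatrices.

(** The rows of [E] are independent modulo [A]: this makes [E] row free and its row space disjoint
    from that of [A], so ranks add. *)
Lemma rank_indep (F : fieldType) m p q (E : 'M[F]_(m, q)) (A : 'M[F]_(p, q)) :
  (forall c : 'rV_m, (c *m E <= A)%MS -> c = 0) ->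
  \rank (E + A)%MS = (m + \rank A)%N.
Proof.
move=> c0.
have rE : \rank E = m.
  apply/eqP; rewrite -[_ == _]/(row_free E) -kermx_eq0; apply/eqP/row_matrixP => i.
  by rewrite row0; apply: c0; rewrite -row_mul mulmx_ker row0 sub0mx.
have EA : (E :&: A = 0)%MS.
  apply/row_matrixP => i; rewrite row0.
  have: (row i (E :&: A) <= E :&: A)%MS by exact: row_sub.
  rewrite sub_capmx => /andP[/submxP[c cE]]; rewrite cE => /c0->.
  by rewrite mul0mx.
by rewrite -{2}rE mxrank_disjoint_sum.
Qed.

Section Components.
Variables (n d : nat).
Local Notation W := (d.-tuple 'I_n).

Section IdealMatrix.
Variables (R : nzRingType) (J : finType) (fam : J -> 'M[R]_n).

(* The degree d part of <U>, for U spanned by fam: the rows are the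
   u * fam j * w, where u and w are obtained by removing two consecutive letters
   from a word of length d. *)
Definition ideal_mx : 'M[R]_(#|{: W * 'I_d.-1 * J}|, #|{: W}|) :=
  fmx (fun (x : W * 'I_d.-1 * J) (v : W) =>
    gcoef (take x.1.2 x.1.1) (drop x.1.2.+2 x.1.1) (fam x.2) v).

End IdealMatrix.

(** Each entry is a sum of entries of the family, so the matrix can be built over a polynomial ring
    and then evaluated or mapped to the fraction field. *)
Lemma map_ideal_mx (R S : nzRingType) (f : {rmorphism R -> S}) (J : finType)
    (fam : J -> 'M[R]_n) :
  map_mx f (ideal_mx fam) = ideal_mx (fun j => map_mx f (fam j)).
Proof.
apply/matrixP => i j; rewrite !mxE rmorph_sum; apply: eq_bigr => a _.
rewrite rmorph_sum; apply: eq_bigr => b _.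
by rewrite rmorphM rmorph_nat mxE.
Qed.

Variable k : fieldType.
Local Notation freeAlg := (freeAlg k n).
Implicit Types (U : {vspace 'M[k]_n}) (f g : freeAlg) (u v w : seq 'I_n).

Definition cvec f : 'rV[k]_#|{: W}| :=
  fvec (fun w : W => monalg.mcoeff (FMonom (w : seq _)) f).

Lemma cvec_is_linear : linear cvec.
Proof. by move=> a f g; apply/rowP => j; rewrite !mxE monalg.mcoeffD monalg.mcoeffZ. Qed.
HB.instance Definition _ :=
  GRing.isLinear.Build k freeAlg 'rV[k]_#|{: W}| _ cvec cvec_is_linear.

Definition form (r : 'rV[k]_#|{: W}|) : freeAlg :=
  \sum_w r 0 (enum_rank w) *: word k w.

Lemma form_is_linear : linear form.
Proof.
move=> a r s; rewrite /form scaler_sumr -big_split; apply: eq_bigr => w _.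
by rewrite !mxE scalerDl scalerA.
Qed.
HB.instance Definition _ :=
  GRing.isLinear.Build k 'rV[k]_#|{: W}| freeAlg _ form form_is_linear.

Lemma homogeneous_form r : homogeneous d (form r).
Proof.
apply: homogeneous_sum => w; apply: homogeneousZ.
by rewrite -[X in homogeneous X](size_tuple w); apply: homogeneous_word.
Qed.

Lemma formK : cancel form cvec.
Proof.
move=> r; rewrite -[RHS]fvecK; apply: eq_fvec => w.
rewrite raddf_sum (bigD1 w) //= big1 => [|w' ww'].
  by rewrite monalg.mcoeffZ mcoeff_word eqxx mulr1 addr0.
by rewrite monalg.mcoeffZ mcoeff_word val_eqE eq_sym (negPf ww') mulr0.
Qed.

Lemma homogeneous_cvec_inj f g :
  homogeneous d f -> homogeneous d g -> cvec f = cvec g -> f = g.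
Proof.
move=> hf hg /fvec_inj fg; apply/malgP => -[v].
have [/eqP dv|dv] := eqVneq (size v) d; first exact: fg (Tuple dv).
have h0 h : homogeneous d h -> monalg.mcoeff (FMonom v) h = 0.
  by move=> hh; apply/eqP; apply: contraNT dv => /hh/eqP.
by rewrite !h0.
Qed.

Lemma cvecK f : homogeneous d f -> form (cvec f) = f.
Proof.
move=> hf; apply: homogeneous_cvec_inj => //; first exact: homogeneous_form.
by rewrite formK.
Qed.

Lemma cvec_qform u w (M : 'M[k]_n) :
  cvec (word k u * qform M * word k w) = fvec (fun v : W => gcoef u w M v).
Proof. by apply: eq_fvec => v; rewrite mcoeff_qform. Qed.

Lemma homogeneous_qform u w (M : 'M[k]_n) :
  (size u + size w).+2 = d -> homogeneous d (word k u * qform M * word k w).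
Proof.
move=> dE [v]; rewrite mcoeff_qform; apply: contra_neq_eq => dv.
rewrite /gcoef big1 // => a _; rewrite big1 // => b _.
case: eqP => [vE|_]; last by rewrite mulr0.
by case/negP: dv; rewrite -dE fdegE /= vE size_cat /= !addnS.
Qed.

Lemma gcoefZ_sum u w (I : finType) (c : I -> k) (M : I -> 'M[k]_n) v :
  gcoef u w (\sum_i c i *: M i) v = \sum_i c i * gcoef u w (M i) v.
Proof.
rewrite -mcoeff_qform (linear_sum (@qform k n)) mulr_sumr mulr_suml raddf_sum.
apply: eq_bigr => i _.
by rewrite linearZ /= freeAlg_scaleAr -scalerAl /= monalg.mcoeffZ mcoeff_qform.
Qed.

Variables (J : finType) (fam : J -> 'M[k]_n) (U : {vspace 'M[k]_n}).
Hypothesis famU : U = <<[seq fam j | j : J]>>%VS.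

Lemma mem_famP M : M \in U -> exists c : J -> k, M = \sum_j c j *: fam j.
Proof.
rewrite famU => MU; have sz : size [seq fam j | j : J] = #|J| by rewrite size_map -cardE.
pose X := Tuple (introT eqP sz).
exists (fun j => coord X (enum_rank j) M).
rewrite {1}(coord_span (X := X) MU) (reindex enum_rank) /=; last exact/onW_bij/enum_rank_bij.
apply: eq_bigr => j _; congr (_ *: _).
by rewrite (nth_map j) -?cardE // nth_enum_rank.
Qed.

Lemma fam_mem j : fam j \in U.
Proof. by rewrite famU; apply/memv_span/map_f; rewrite mem_enum. Qed.

Lemma gcoef_sub u w M : M \in U ->
  (fvec (fun v : W => gcoef u w M v) <= ideal_mx fam)%MS.
Proof.
move=> /mem_famP[c ->].
rewrite (eq_fvec (g := fun v : W => \sum_j c j * gcoef u w (fam j) v));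
  last by move=> v; rewrite gcoefZ_sum.
rewrite fvec_sum summx_sub // => j _; rewrite fvecZ scalemx_sub //.
(* A letter is needed to complete [u] and [w] to a word that indexes a row; without letters every
   coefficient vanishes. *)
have [i _|no_i] := pickP 'I_n; last first.
  rewrite (eq_fvec (g := fun=> 0)) ?fvec0 ?sub0mx // => v.
  by rewrite /gcoef big1 // => a; have := no_i a.
(* If the total length is not [d], no word of length [d] occurs and the vector is zero. *)
have [/eqP dE|dE] := eqVneq (size (u ++ [:: i, i & w])) d; last first.
  rewrite (eq_fvec (g := fun=> 0)) ?fvec0 ?sub0mx // => v.
  rewrite /gcoef big1 // => a _; rewrite big1 // => b _.
  case: eqP => [vE|_]; last by rewrite mulr0.
  by case/negP: dE; rewrite -(size_tuple v) vE !size_cat.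
have ud : (size u < d.-1)%N.
  by rewrite -(eqP dE) size_cat /= !addnS /= ltnS leq_addr.
have := fvec_sub (fun (x : W * 'I_d.-1 * J) (v : W) =>
  gcoef (take x.1.2 x.1.1) (drop x.1.2.+2 x.1.1) (fam x.2) v)
  (Tuple dE, Ordinal ud, j).
by rewrite /= take_size_cat // drop_cat ltnNge leqW //= -addn2 addKn /= drop0.
Qed.

(** [<U>] is a graded ideal: [cvec] extracts the component of degree [d], and products of another
    degree have the zero vector. *)
Lemma ideal_cvec f : in_ideal U f -> (cvec f <= ideal_mx fam)%MS.
Proof.
case=> s sU ->; rewrite linear_sum; elim: s sU => [|[[f1 M] f2] s IHs] sU /=.
  by rewrite big_nil sub0mx.
rewrite big_cons addmx_sub //; last first.
  by apply: IHs => t ts; apply: sU; rewrite inE ts orbT.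
have /= MU := sU _ (mem_head _ _).
rewrite mul_wordE (linear_sum cvec) summx_sub // => u _.
rewrite (linear_sum cvec) summx_sub // => w _.
rewrite linearZ /= scalemx_sub //.
by rewrite cvec_qform gcoef_sub.
Qed.

Lemma cvec_ideal f :
  homogeneous d f -> (cvec f <= ideal_mx fam)%MS -> in_ideal U f.
Proof.
move=> hf /sub_fmxP[c fE]; rewrite -(cvecK hf) fE linear_sum.
apply: ideal_sum => -[[t i] j] _ /=; rewrite linearZ; apply: idealZ => /=.
rewrite -cvec_qform cvecK; last first.
  (* A position [i < d.-1] forces [d >= 2], and removing the letters at [i] and [i.+1] leaves
     [d - 2] of them. *)
  apply: homogeneous_qform; rewrite size_take size_drop size_tuple.
  case: i => i /=; case: d => // -[//|d'] /= id'.
  by rewrite ltnS ltnW // subSS subSS subnKC.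
exact/ideal_mul/ideal_qform/fam_mem.
Qed.

(** The conditions on [e] in [has_dim] say that its coordinate vectors form a basis of a complement
    of the row space of [ideal_mx]; dimensions thus become ranks. *)
Lemma has_dimP m :
  has_dim U d m <-> (m + \rank (ideal_mx fam) = n ^ d)%N.
Proof.
have <- : #|{: W}| = (n ^ d)%N by rewrite card_tuple card_ord.
split=> [[e [he free_e span_e]]|mE].
  pose E : 'M[k]_(m, _) := \matrix_i cvec (e i).
  have EE (c : 'rV[k]_m) : c *m E = cvec (\sum_i c 0 i *: e i).
    rewrite mulmx_sum_row linear_sum; apply: eq_bigr => i _.
    by rewrite rowK linearZ.
  have hE (c : 'I_m -> k) : homogeneous d (\sum_i c i *: e i).
    by apply: homogeneous_sum => i; apply: homogeneousZ.
  have c0 (c : 'rV[k]_m) : (c *m E <= ideal_mx fam)%MS -> c = 0.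
    rewrite EE => /(cvec_ideal (hE _))/free_e c0.
    by apply/rowP => i; rewrite c0 mxE.
  have full : row_full (E + ideal_mx fam)%MS.
    rewrite -sub1mx; apply/row_subP => i.
    have [c /ideal_cvec] := span_e _ (@homogeneous_form (row i 1%:M)).
    rewrite linearB /= formK => h.
    rewrite -(subrK (cvec (\sum_i0 c i0 *: e i0)) (row i 1%:M)) addmx_sub //.
      exact: submx_trans h (addsmxSr _ _).
    have -> : cvec (\sum_i0 c i0 *: e i0) = (\row_i0 c i0) *m E.
      by rewrite EE; apply: (congr1 cvec); apply: eq_bigr => j _; rewrite mxE.
    exact: submx_trans (submxMl _ _) (addsmxSl _ _).
  by apply/eqP; rewrite -(rank_indep c0).
pose C := (ideal_mx fam)^C%MS.
have rC : \rank C = m by rewrite mxrank_compl; apply/eqP;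
  rewrite -(eqn_add2r (\rank (ideal_mx fam))) mE subnK // rank_leq_col.
case: m / rC {mE}.
pose e i := form (row i (row_base C)).
have eE (c : 'I_(\rank C) -> k) :
    cvec (\sum_i c i *: e i) = (\row_i c i) *m row_base C.
  rewrite linear_sum mulmx_sum_row; apply: eq_bigr => i _.
  by rewrite linearZ /= formK mxE.
exists e; split=> [i|c cI i|f hf]; first exact: homogeneous_form.
  have := ideal_cvec cI; rewrite eE => cI'.
  have: ((\row_i c i) *m row_base C <= ideal_mx fam :&: C)%MS.
    by rewrite sub_capmx cI' (submx_trans (submxMl _ _)) ?eq_row_base.
  rewrite capmx_compl submx0 mulmx_free_eq0 ?row_base_free // => /eqP/rowP/(_ i).
  by rewrite !mxE.
have: (cvec f <= row_base C + ideal_mx fam)%MS.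
  rewrite (adds_eqmx (eq_row_base C) (eqmx_refl _)) addsmxC.
  by rewrite submx_full // addsmx_compl_full.
case/sub_addsmxP => -[c1 c2] /= fE; exists (fun i => c1 0 i).
apply: cvec_ideal.
  by apply: homogeneousB => //; apply: homogeneous_sum => i;
     apply/homogeneousZ/homogeneous_form.
rewrite linearB /= eE fE (_ : \row_i c1 0 i = c1).
  by rewrite addrC addKr submxMl.
by apply/rowP => i; rewrite mxE.
Qed.

End Components.

Section Dimensions.
Variables (k : fieldType) (n : nat).
Local Notation freeAlg := (freeAlg k n).
Implicit Types (U : {vspace 'M[k]_n}).

Definition vfam U (i : 'I_(\dim U)) : 'M[k]_n := (vbasis U)`_i.

Lemma span_vfam U : U = <<[seq vfam i | i : 'I_(\dim U)]>>%VS.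
Proof.
rewrite -[LHS](span_basis (vbasisP U)); congr <<_>>%VS.
by rewrite -[LHS]map_tnth_enum; apply: eq_map => i; rewrite (tnth_nth 0).
Qed.

Definition ideal_rank U d := \rank (ideal_mx d (@vfam U)).

Lemma ideal_rank_le U d : (ideal_rank U d <= n ^ d)%N.
Proof. by apply: leq_trans (rank_leq_col _) _; rewrite card_tuple card_ord. Qed.

Lemma has_dimE U d m : has_dim U d m <-> (m + ideal_rank U d = n ^ d)%N.
Proof.
exact: has_dimP (span_vfam U) m.
Qed.

(** Both ranks are [n ^ d] minus the same dimension, whichever spanning family is chosen. *)
Lemma ideal_rankE (J : finType) (fam : J -> 'M[k]_n) d :
  \rank (ideal_mx d fam) = ideal_rank <<[seq fam j | j : J]>>%VS d.
Proof.
set U := span _; have Ule := ideal_rank_le U d.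
have := iffRL (has_dimE U d (n ^ d - ideal_rank U d)) (subnK Ule).
by rewrite (has_dimP d (erefl U)) -{2}(subnK Ule) => /addnI.
Qed.

Lemma has_dim_exists U d : exists m, has_dim U d m.
Proof.
exists (n ^ d - ideal_rank U d)%N; apply/has_dimE; exact/subnK/ideal_rank_le.
Qed.

(** Tool for upper bounds: once words reduce to combinations of [e], the vectors of [e] and the
    ideal fill the whole space. *)
Lemma has_dim_le_span U d m (I : finType) (e : I -> freeAlg) :
    (forall w : d.-tuple 'I_n,
       exists c : I -> k, in_ideal U (word k w - \sum_i c i *: e i)) ->
  has_dim U d m -> (m <= #|I|)%N.
Proof.
move=> span_e /has_dimE mE.
have NE : #|{: d.-tuple 'I_n}| = (n ^ d)%N by rewrite card_tuple card_ord.
pose E : 'M[k]_(#|I|, #|{: d.-tuple 'I_n}|) := \matrix_i cvec d (e (enum_val i)).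
rewrite -(leq_add2r (ideal_rank U d)) mE -NE.
suff full : row_full (E + ideal_mx d (@vfam U))%MS.
  apply: leq_trans (eq_leq (esym (eqP full))) (leq_trans (mxrank_adds_leqif _ _) _).
  by rewrite leq_add2r rank_leq_row.
rewrite -sub1mx; apply/row_subP => j; pose w := enum_val j.
have -> : row j 1%:M = cvec d (word k w).
  apply/rowP => i; rewrite !mxE mcoeff_word val_eqE.
  by rewrite /w (inj_eq enum_val_inj) eq_sym.
have [c /(ideal_cvec d (span_vfam U)) h] := span_e w.
rewrite -(subrK (cvec d (\sum_i c i *: e i)) (cvec d _)) addmx_sub //.
  by move: h; rewrite linearB => h; apply: submx_trans h (addsmxSr _ _).
rewrite (linear_sum (@cvec n d k)) summx_sub // => i _; rewrite linearZ /= scalemx_sub //.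
apply: submx_trans (addsmxSl _ _).
have -> : cvec d (e i) = row (enum_rank i) E by rewrite rowK enum_rankK.
exact: row_sub.
Qed.

(** Tool for lower bounds: the linear extension of [h] kills [<U>], so a dependency modulo [<U>]
    between words of [P] gives one between their images. *)
Lemma has_dim_ge_free U d m (V : lmodType k) (h : seq 'I_n -> V)
    (P : pred (d.-tuple 'I_n)) :
    (forall u w M, M \in U ->
       \sum_a \sum_b M a b *: h (u ++ [:: a, b & w]) = 0) ->
    (forall c : d.-tuple 'I_n -> k,
       \sum_(w | P w) c w *: h w = 0 -> forall w, P w -> c w = 0) ->
  has_dim U d m -> (#|P| <= m)%N.
Proof.
move=> hU free_h /has_dimE mE.
have NE : #|{: d.-tuple 'I_n}| = (n ^ d)%N by rewrite card_tuple card_ord.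
pose A := ideal_mx d (@vfam U).
pose phi (r : 'rV[k]_#|{: d.-tuple 'I_n}|) := \sum_w r 0 (enum_rank w) *: h w.
have phiD a r s : phi (a *: r + s) = a *: phi r + phi s.
  rewrite scaler_sumr -big_split; apply: eq_bigr => w _.
  by rewrite !mxE scalerDl scalerA.
have phi0 : phi 0 = 0 by rewrite /phi big1 // => w _; rewrite mxE scale0r.
have phiA r : (r <= A)%MS -> phi r = 0.
  case/sub_fmxP => c ->; apply: (big_ind (fun r => phi r = 0)) => // [r' s r0 s0|x _].
    by rewrite -[r']scale1r phiD r0 s0 scaler0 addr0.
  rewrite -[_ *: _]addr0 phiD phi0 addr0 (_ : phi _ = 0) ?scaler0 //.
  have [t i] : d.-tuple 'I_n * 'I_d.-1 := x.1.
  set u := take _ _; set w := drop _ _; set M := vfam _.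
  have duw : (size u + size w).+2 = d.
    rewrite /u /w size_take size_drop size_tuple.
    case: (x.1.2) => j /=; case: (d) => // -[//|d'] /= jd.
    by rewrite ltnS ltnW // subSS subSS subnKC.
  rewrite -[RHS](hU u w M); last exact: (fam_mem (span_vfam U)).
  rewrite /phi; under eq_bigr => v _.
    rewrite mxE enum_rankK scaler_suml.
    under eq_bigr => a _ do rewrite scaler_suml.
    over.
  rewrite exchange_big; apply: eq_bigr => a _.
  rewrite exchange_big; apply: eq_bigr => b _ /=.
  have dv : size (u ++ [:: a, b & w]) == d by rewrite size_cat /= !addnS duw.
  rewrite (bigD1 (Tuple dv)) //= eqxx mulr1 big1 ?addr0 // => v.
  by rewrite -val_eqE /= => /negPf->; rewrite mulr0 scale0r.
(* The rows of [E] are the words of [P] as basis vectors; a combination of them lying in the ideal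
   is killed by [phi]. *)
pose E : 'M[k]_(#|P|, #|{: d.-tuple 'I_n}|) :=
  \matrix_i delta_mx 0 (enum_rank (enum_val i)).
rewrite -(leq_add2r (\rank A)) [X in (_ <= X)%N]mE -NE -(@rank_indep _ _ _ _ E) ?rank_leq_col
  // => c.
move=> /phiA cE0; pose c' w := (c *m E) 0 (enum_rank w).
have c'E w : c' w = \sum_i c 0 i * (w == enum_val i)%:R.
  rewrite /c' mxE; apply: eq_bigr => i _.
  by rewrite !mxE eqxx (inj_eq enum_rank_inj).
have c'0 w : w \in P -> c' w = 0.
  apply: free_h; rewrite -[RHS]cE0 /phi [RHS](bigID P) /= [X in _ + X]big1 ?addr0 // => v vP.
  rewrite [X in X *: _](c'E v) big1 ?scale0r // => i _; case: eqP => [vi|_]; last exact: mulr0.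
  by case/negP: vP; rewrite vi; have := enum_valP i.
apply/rowP => i; rewrite [RHS]mxE -[RHS](c'0 _ (enum_valP i)) c'E (bigD1 i) //= eqxx mulr1.
rewrite big1 ?addr0 // => j ji; rewrite (inj_eq enum_val_inj) eq_sym (negPf ji).
exact: mulr0.
Qed.

End Dimensions.

(** * Semicontinuity *)

Section Semicontinuity.

(** The minor argument: [X] and [Y] over [k0] compress [map_mx ev A] to an identity matrix of size
    its rank. The determinant of the same compression of [A] evaluates to 1, so it is nonzero and
    stays so under the injective [j]. *)
Lemma rank_specialize (k0 K : fieldType) (R : comNzRingType)
    (iota : {rmorphism k0 -> R}) (ev : {rmorphism R -> k0}) (j : {rmorphism R -> K})
    p q (A : 'M[R]_(p, q)) :
  cancel iota ev -> injective j -> (\rank (map_mx ev A) <= \rank (map_mx j A))%N.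
Proof.
move=> iotaK j_inj; set B := map_mx ev A.
pose X := pinvmx (col_base B); pose Y := pinvmx (row_base B).
have XBY : X *m B *m Y = 1%:M.
  rewrite -[B in X *m B]mulmx_base mulmxA mulVpmx ?col_base_full // mul1mx.
  by rewrite mulmxVp ?row_base_free.
have mapK a b (Z : 'M[k0]_(a, b)) : map_mx ev (map_mx iota Z) = Z.
  by apply/matrixP => i i'; rewrite !mxE iotaK.
pose D := map_mx iota X *m A *m map_mx iota Y.
have evD : map_mx ev D = 1%:M.
  by rewrite !map_mxM !mapK XBY.
have D0 : \det (map_mx j D) != 0.
  rewrite det_map_mx -(rmorph0 j) (inj_eq j_inj).
  apply: contra_eq_neq (det1 k0 (\rank B)) => D0.
  by rewrite -evD det_map_mx D0 rmorph0 eq_sym oner_eq0.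
have: map_mx j D \in unitmx by rewrite unitmxE unitfE.
rewrite -row_full_unit => /eqP <-; rewrite !map_mxM.
exact: leq_trans (mxrankM_maxl _ _) (mxrankM_maxr _ _).
Qed.

Section RelationFamily.
Variables (C : qclass) (n r : nat).

(** [mon2_form] over any ring, because semicontinuity works with matrices over a polynomial ring. *)
Definition mon2_mx (R : nzRingType) (p : 'I_n * 'I_n) : 'M[R]_n :=
  if C is LieType then
    if p.1 == p.2 then delta_mx p.1 p.1
    else delta_mx p.1 p.2 + delta_mx p.2 p.1
  else delta_mx p.1 p.2.

(** Relations and commutators in a single family; outside the commutative class the commutator slots
    hold zero matrices, which leave the span unchanged. *)
Definition rel_fam (R : nzRingType) (c : 'I_r -> mon2 C n -> R)
    (j : 'I_r + 'I_n * 'I_n) : 'M[R]_n :=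
  match j with
  | inl i => \sum_p c i p *: mon2_mx R (val p)
  | inr p => if C is Commutative then delta_mx p.1 p.2 - delta_mx p.2 p.1 else 0
  end.

Lemma map_rel_fam (R S : nzRingType) (f : {rmorphism R -> S})
    (c : 'I_r -> mon2 C n -> R) (j : 'I_r + 'I_n * 'I_n) :
  map_mx f (rel_fam c j) = rel_fam (fun i p => f (c i p)) j.
Proof.
case: j => [i|p] /=; last first.
  by case: C => //; rewrite ?map_mx0 // map_mxB !map_delta_mx.
rewrite map_mx_sum; apply: eq_bigr => p _; rewrite map_mxZ; congr (_ *: _).
rewrite /mon2_mx; move: (val p) => q.
by case: C => //; try case: ifP => _; rewrite ?map_mxD ?map_delta_mx.
Qed.

Lemma rel_spaceE (k : fieldType) (c : 'I_r -> mon2 C n -> k) :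
  rel_space c = <<[seq rel_fam c j | j : 'I_r + 'I_n * 'I_n]>>%VS.
Proof.
apply: subv_anti; apply/andP; split; rewrite /rel_space.
  rewrite subv_add; apply/andP; split.
    apply/span_subvP => M /mapP[i _ ->]; apply/memv_span.
    by apply/mapP; exists (inl i); rewrite ?mem_enum.
  have inX p : rel_fam c (inr p) \in <<[seq rel_fam c j | j : 'I_r + 'I_n * 'I_n]>>%VS.
    by apply/memv_span/map_f; rewrite mem_enum.
  move: <<_>>%VS inX => /= X; rewrite /built_in; case: C => inX; rewrite ?sub0v //.
  by apply/span_subvP => M /mapP[p _ ->]; apply: inX.
apply/span_subvP => M /mapP[[i|p] _ ->] /=.
  apply: (subvP (addvSl _ _)); apply/memv_span/mapP; exists i => //.
  by rewrite mem_enum.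
apply: (subvP (addvSr _ _)); rewrite /built_in.
case: C => /=; rewrite ?mem0v //; apply/memv_span/mapP; exists p => //.
by rewrite mem_enum.
Qed.

(** Both ideals come from one matrix over the polynomial ring in the coefficients, by evaluation at
    [c] and by embedding in the fraction field. Evaluation can only lower the rank, hence only raise
    the dimension. *)
Lemma has_dim_specialize (k0 : fieldType) (c : 'I_r -> mon2 C n -> k0) d m m0 :
  has_dim (generic_rel k0 C n r) d m -> has_dim (rel_space c) d m0 -> (m <= m0)%N.
Proof.
move=> /has_dimE mE /has_dimE m0E.
rewrite -(leq_add2r (ideal_rank (generic_rel k0 C n r) d)) mE -m0E leq_add2l.
rewrite /generic_rel !rel_spaceE -!ideal_rankE.
pose v (x : 'I_(num_coef C n r)) := c (enum_val x).1 (enum_val x).2.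
pose ev := mpoly.meval v.
pose X i p : mpoly (num_coef C n r) k0 := 'X_(enum_rank (i, p)).
rewrite (_ : ideal_mx d (rel_fam c) = map_mx ev (ideal_mx d (rel_fam X))); last first.
  rewrite map_ideal_mx; apply/matrixP => i j; rewrite !mxE; apply: eq_bigr => a _.
  apply: eq_bigr => b _; congr (_ * _); rewrite map_rel_fam.
  congr (fun_of_matrix _ _ _); case: (enum_val i).2 => //= x.
  by apply: eq_bigr => p _; rewrite /ev mevalXU /v enum_rankK.
rewrite (_ : ideal_mx d (rel_fam (@indet_coef k0 C n r)) =
    map_mx (@FracField.tofrac _) (ideal_mx d (rel_fam X))).
  apply: (@rank_specialize _ _ _ (@mpolyC _ k0)) => [x|]; first exact: mevalC.
  by move=> x y /eqP; rewrite tofrac_eq => /eqP.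
rewrite map_ideal_mx; apply/matrixP => i j; rewrite !mxE; apply: eq_bigr => a _.
by apply: eq_bigr => b _; congr (_ * _); rewrite map_rel_fam.
Qed.

End RelationFamily.
End Semicontinuity.

(** * Koszul duals and types *)

Section KoszulDual.
Variables (k : fieldType) (n : nat).
Implicit Types U : {vspace 'M[k]_n}.

Lemma pairingE (A B : 'M[k]_n) : pairing A B = (mxvec A *m (mxvec B)^T) 0 0.
Proof.
rewrite /pairing mxE pair_bigA (reindex _ (curry_mxvec_bij n n)) /=.
by apply: eq_bigr => -[i j] _; rewrite !mxE !mxvecE.
Qed.

Lemma pairingC (A B : 'M[k]_n) : pairing A B = pairing B A.
Proof. by apply: eq_bigr => i _; apply: eq_bigr => j _; rewrite mulrC. Qed.

(** The dual is the kernel of the map sending [B] to [mxvec B *m A^T], where the rows of [A] are a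
    basis of [U]; this map is onto because [A] is row free. *)
Lemma dim_koszul_dual U : (\dim (koszul_dual U) + \dim U = n ^ 2)%N.
Proof.
pose A := \matrix_i mxvec (@vfam k n U i).
have sumA (c : 'rV_(\dim U)) : c *m A = mxvec (\sum_i c 0 i *: vfam i).
  by rewrite mulmx_sum_row linear_sum; apply: eq_bigr => i _; rewrite rowK linearZ.
have freeA : row_free A.
  rewrite -kermx_eq0; apply/eqP/row_matrixP => i; rewrite row0.
  set c := row i _; have: c *m A = 0 by rewrite -row_mul mulmx_ker row0.
  rewrite sumA => /(canRL mxvecK); rewrite linear0 => c0.
  have /freeP free_U : free (vbasis U) := basis_free (vbasisP U).
  by apply/rowP => j; rewrite [RHS]mxE; apply: (free_U (c 0)).
pose f := linfun (mulmxr A^T \o @mxvec k n n).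
have fE B : f B = mxvec B *m A^T by rewrite lfunE.
have -> : koszul_dual U = lker f.
  apply/vspaceP => B; rewrite memv_ker fE; apply/koszul_dualP/eqP => [U0|fB0 M MU].
    apply/rowP => i; rewrite !mxE -[RHS](U0 (vfam i)) ?(fam_mem (span_vfam U)) //.
    by rewrite pairingC pairingE mxE; apply: eq_bigr => j _; rewrite !mxE.
  rewrite (coord_vbasis MU) pairingC linear_sum big1 // => i _.
  rewrite linearZ /= -[pairing _ _]/(pairing B (vfam i)) (_ : pairing B _ = 0) ?scaler0 //.
  have /rowP/(_ i) := fB0; rewrite !mxE => <-.
  by rewrite pairingE mxE; apply: eq_bigr => j _; rewrite !mxE.
have imE : \dim (limg f) = \dim U.
  have -> : limg f = fullv.
    apply/vspaceP => r; rewrite memvf; apply/memv_imgP.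
    exists (vec_mx (r *m (pinvmx A)^T)); first exact: memvf.
    by rewrite fE vec_mxK -mulmxA -trmx_mul mulmxVp // trmx1 mulmx1.
  by rewrite dimvf /dim /= mul1n.
by rewrite -[X in _ = X]/(dim 'M[k]_n) -dimvf -(limg_ker_dim f fullv) capfv imE.
Qed.

(** [U] lies in its double dual by symmetry of the pairing, and the dimensions agree. *)
Lemma koszul_dualK : involutive (@koszul_dual k n).
Proof.
move=> U; apply/esym/eqP; rewrite eqEdim; apply/andP; split.
  apply/subvP => A AU; apply/koszul_dualP => B /koszul_dualP BU.
  by rewrite pairingC; apply: BU.
have := dim_koszul_dual (koszul_dual U).
by rewrite -(dim_koszul_dual U) [RHS]addnC => /addIn->.
Qed.

(* J indexes the relations, and l their leading monomials. *)
Lemma dim_span_lead (J : finType) (fam : J -> 'M[k]_n) (l : J -> 'I_n * 'I_n) :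
  (forall i j, fam i (l j).1 (l j).2 = (i == j)%:R) ->
  \dim <<[seq fam j | j : J]>> = #|J|.
Proof.
move=> famE; have sz : size [seq fam j | j : J] = #|J| by rewrite size_map -cardE.
pose X := Tuple (introT eqP sz).
suff: free X by move/eqP; rewrite /= sz.
apply/freeP => c c0 i.
have := congr1 (fun M : 'M_n => M (l (enum_val i)).1 (l (enum_val i)).2) c0.
have XE (j : 'I_#|J|) : X`_j = fam (enum_val j).
  by rewrite /= (nth_map (enum_val i)) -?cardE // -enum_val_nth.
rewrite mxE summxE (bigD1 i) //= big1 => [|j ji].
  by rewrite -[nth _ _ _]/(X`_i) XE mxE famE eqxx mulr1 addr0.
rewrite -[nth _ _ _]/(X`_j) XE mxE famE (inj_eq enum_val_inj) (negPf ji).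
exact: mulr0.
Qed.

End KoszulDual.

Section BuiltIn.
Variable n : nat.

Definition offdiag := {p : 'I_n * 'I_n | (p.1 < p.2)%N}.

Lemma card_offdiag : #|{: offdiag}| = 'C(n, 2).
Proof.
rewrite card_sig -sum1_card.
rewrite (eq_bigl (fun p : 'I_n * 'I_n => true && (p.1 < p.2)%N)) //.
rewrite -(pair_big_dep (fun=> true) (fun i j : 'I_n => (i < j)%N) (fun _ _ => 1%N)).
rewrite (exchange_big_dep predT) // -bin2_sum big_mkord; apply: eq_bigr => j _.
rewrite sum1_card -[RHS]card_ord -(card_image (f := widen_ord (ltnW (ltn_ord j)))).
  apply: eq_card => i; apply/idP/imageP => [ij|[i' _ ->]]; last exact: (ltn_ord i').
  by exists (Ordinal ij) => //; apply: val_inj.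
by move=> i i' /(congr1 val) /= ii'; apply: val_inj.
Qed.

Lemma built_inE (k : fieldType) : built_in k Commutative n =
  <<[seq delta_mx (val p).1 (val p).2 - delta_mx (val p).2 (val p).1 | p : offdiag]>>%VS.
Proof.
apply: subv_anti; apply/andP; split; apply/span_subvP => M /mapP[p _ ->]; last first.
  by apply/memv_span/map_f; rewrite mem_enum.
set S := span _.
have SP (i j : 'I_n) : (i < j)%N -> delta_mx i j - delta_mx j i \in S.
  by move=> ij; apply/memv_span/mapP; exists (Sub (i, j) ij); rewrite ?mem_enum.
case: (ltngtP p.1 p.2) => [/SP//|/SP|/val_inj->]; last by rewrite subrr mem0v.
by rewrite -opprB memvN.
Qed.

Lemma dim_built_in (k : fieldType) : \dim (built_in k Commutative n) = 'C(n, 2).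
Proof.
rewrite built_inE -card_offdiag; apply: (dim_span_lead (l := val)) => p q.
rewrite !mxE; case: p q => [[a b] /= ab] [[c d] /= cd].
rewrite -[exist _ _ _ == exist _ _ _]/((a == c) && (b == d)).
rewrite [c == a]eq_sym [d == b]eq_sym.
have [cb|_] := eqVneq c b; last by rewrite subr0.
have [da|_] := eqVneq d a; last by rewrite subr0.
by move: cd; rewrite cb da ltnNge ltnW.
Qed.

(* The admissible pair with the same entries as q. *)
Definition srt (q : 'I_n * 'I_n) : {p : 'I_n * 'I_n | (p.1 <= p.2)%N} :=
  match leqP q.1 q.2 with
  | LeqNotGtn h => exist _ (q.1, q.2) h
  | GtnNotLeq h => exist _ (q.2, q.1) (ltnW h)
  end.

Lemma val_srt q : val (srt q) = if (q.1 <= q.2)%N then q else (q.2, q.1).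
Proof. by case: q => i j; rewrite /srt /=; case: leqP. Qed.

Variable k : fieldType.
Implicit Types U : {vspace 'M[k]_n}.

Lemma mem_vfam U i : @vfam k n U i \in U.
Proof. exact: (fam_mem (span_vfam U)). Qed.

Lemma vfam_free U : free [seq @vfam k n U i | i : 'I_(\dim U)].
Proof.
by rewrite /free -span_vfam size_map -cardE card_ord.
Qed.

Lemma of_type_noncomm U : of_type NonCommutative (\dim U) U.
Proof.
exists (fun i p => vfam i (val p).1 (val p).2).
suff relE : relations (fun i (p : mon2 NonCommutative n) => @vfam k n U i (val p).1 (val p).2)
    = [seq vfam i | i : 'I_(\dim U)].
  by rewrite /rel_space relE addv0 -span_vfam; split=> //; exact: vfam_free.
apply: eq_map => i; rewrite [RHS]matrix_sum_delta pair_bigA.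
rewrite (reindex (fun p : mon2 NonCommutative n => val p)) //=.
by exists (fun q => Sub q isT) => [p _|q _]; [apply: val_inj|].
Qed.

Lemma sum_srt (M : 'M[k]_n) (D : 'I_n * 'I_n -> 'M[k]_n) :
  \sum_p (\sum_(q | srt q == p) M q.1 q.2) *: D (val p) =
  \sum_q M q.1 q.2 *: D (val (srt q)).
Proof.
rewrite [RHS](partition_big srt predT) //; apply: eq_bigr => p _.
by rewrite scaler_suml; apply: eq_bigr => q /eqP->.
Qed.

(** The relations are read off a basis of a complement [W] of the commutators in [U]. Adding up the
    entries at [(i, j)] and [(j, i)] changes a matrix only by commutators, so the total span is
    still [U]; independence follows by counting dimensions. *)
Lemma of_type_comm U : (built_in k Commutative n <= U)%VS ->
  of_type Commutative (\dim U - 'C(n, 2)) U.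
Proof.
move=> BU; set B := built_in k Commutative n in BU *.
pose W := (U :\: B)%VS.
have dW : \dim W = (\dim U - 'C(n, 2))%N.
  have := dimv_cap_compl U B; rewrite (capv_idPr BU) -/W dim_built_in => <-.
  by rewrite addKn.
rewrite -dW; pose c i (p : mon2 Commutative n) := 
  \sum_(q | srt q == p) @vfam k n W i q.1 q.2.
exists c.
have cE i : vfam i - \sum_p c i p *: mon2_form k Commutative (val p) \in B.
  rewrite (sum_srt (vfam i) (fun q => delta_mx q.1 q.2)).
  rewrite {1}[vfam i]matrix_sum_delta pair_bigA -sumrB memv_suml // => q _ /=.
  rewrite -scalerBr memvZ // val_srt; case: leqP => _ /=; first by rewrite subrr mem0v.
  apply/memv_span/mapP; exists q; rewrite ?mem_enum //.
have UE : U = rel_space c.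
  apply: subv_anti; apply/andP; split.
    rewrite -(addv_diff_cap U B) (capv_idPr BU) -/W /rel_space subv_add addvSr andbT.
    rewrite {1}[W]span_vfam; apply/span_subvP => M /mapP[i _ ->].
    rewrite -(subrK (\sum_p c i p *: mon2_form k Commutative (val p)) (vfam i)) addrC.
    rewrite memv_add ?cE //; apply/memv_span/map_f.
    by rewrite mem_enum.
  rewrite subv_add BU andbT; apply/span_subvP => M /mapP[i _ ->].
  rewrite -(subKr (vfam i) (\sum_p _)) memvB //.
    by apply: (subvP (diffvSl U B)); apply: mem_vfam.
  exact: (subvP BU).
split=> //.
have sz : size (relations c) = \dim W by rewrite size_map -cardE card_ord.
rewrite /free eqn_leq dim_span andTb sz.
apply: leq_trans (eq_leq dW) _; rewrite leq_subLR addnC -(dim_built_in k) {1}UE.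
exact: dimv_add_leqif.
Qed.

Lemma lie_relE (c : mon2 LieType n -> k) a b :
  (\sum_p c p *: mon2_form k LieType (val p)) a b = c (srt (a, b)).
Proof.
have formE p : mon2_form k LieType (val p) a b = (p == srt (a, b))%:R.
  rewrite -val_eqE val_srt /=; case: p => -[i j] /= ij.
  have [eij|nij] := eqVneq i j; rewrite !mxE.
    rewrite -eij [a == i]eq_sym [b == i]eq_sym.
    by case: leqP => _; rewrite -pair_eqE /pair_eq //= andbC.
  case: leqP => ab; rewrite -pair_eqE /pair_eq /= [i == _]eq_sym [j == _]eq_sym.
    case: (@andP (a == j) (b == i)) => [[/eqP aj /eqP bi]|_]; last by rewrite addr0.
    by case/eqP: nij; apply/val_inj/anti_leq; rewrite ij -aj -bi.
  rewrite [(b == i) && _]andbC; case: (_ =P i) => [ai|_]; last by rewrite add0r.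
  by case: (_ =P j) => [bj|_]; [move: ij; rewrite -ai -bj leqNgt ab | rewrite add0r].
rewrite summxE (bigD1 (srt (a, b))) //= mxE formE eqxx mulr1 big1 ?addr0 // => p /negPf pab.
by rewrite mxE formE pab mulr0.
Qed.

(** A symmetric matrix is the relation whose coefficients are its entries on and above the
    diagonal. *)
Lemma of_type_lie U : (forall M, M \in U -> M^T = M) -> of_type LieType (\dim U) U.
Proof.
move=> symU; exists (fun i p => vfam i (val p).1 (val p).2).
suff relE : relations (fun i (p : mon2 LieType n) => @vfam k n U i (val p).1 (val p).2)
    = [seq vfam i | i : 'I_(\dim U)].
  by rewrite /rel_space relE addv0 -span_vfam; split=> //; exact: vfam_free.
apply: eq_map => i; apply/matrixP => a b; rewrite lie_relE val_srt.
by case: leqP => // _; rewrite -[in RHS](symU _ (mem_vfam i)) mxE.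
Qed.

Lemma gcoef_nil (M : 'M[k]_n) a b : gcoef [::] [::] M [:: a; b] = M a b.
Proof.
rewrite /gcoef (bigD1 a) // -[RHS]addr0; congr (_ + _); last first.
  rewrite big1 // => i ia; rewrite big1 // => j _.
  by rewrite !eqseq_cons [a == i]eq_sym (negPf ia) mulr0.
rewrite (bigD1 b) // -[RHS]addr0; congr (_ + _); first by rewrite eqxx mulr1.
rewrite big1 // => j jb.
by rewrite !eqseq_cons [b == j]eq_sym (negPf jb) andbF mulr0.
Qed.

(** For [d < 2] the type ['I_d.-1] of positions is empty, so the matrix has no row. *)
Lemma ideal_rank_lt2 U d : (d < 2)%N -> ideal_rank U d = 0%N.
Proof.
move=> d2; apply/eqP; rewrite -leqn0; apply: leq_trans (rank_leq_row _) _.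
by rewrite !card_prod !card_ord; case: d d2 => [|[]] // _; rewrite muln0.
Qed.

(** In degree 2 the only position is 0 and both outer words are empty: the rows are the basis of
    [U], with repetitions. *)
Lemma ideal_rank2 U : ideal_rank U 2 = \dim U.
Proof.
pose F := fmx (fun (j : 'I_(\dim U)) (v : 2.-tuple 'I_n) => gcoef [::] [::] (vfam j) v).
have freeF : row_free F.
  rewrite -kermx_eq0; apply/eqP/row_matrixP => i; rewrite row0.
  set c := row i _; have: c *m F = 0 by rewrite -row_mul mulmx_ker row0.
  rewrite mulmx_sum_row (reindex enum_rank) /=; last exact/onW_bij/enum_rank_bij.
  pose e j := c 0 (enum_rank j) => c0.
  have M0 : \sum_j e j *: vfam j = 0.
    apply/matrixP => a b; rewrite [RHS]mxE -gcoef_nil.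
    apply: (@fvec_inj _ _ (fun v : 2.-tuple 'I_n =>
      gcoef [::] [::] (\sum_j e j *: vfam j) v) (fun=> 0) _ [tuple a; b]).
    rewrite fvec0 -[RHS]c0.
    under eq_fvec do rewrite gcoefZ_sum.
    rewrite fvec_sum.
    by apply: eq_bigr => j _; rewrite fvecZ row_fmx enum_rankK.
  have /freeP free_U : free (vbasis U) := basis_free (vbasisP U).
  apply/rowP => j; rewrite [RHS]mxE -[j]enum_valK.
  exact: free_U M0 (enum_val j).
have UF : (ideal_mx 2 (@vfam k n U) :=: F)%MS.
  apply/eqmxP/andP; split; apply/fmx_subP.
    move=> [[t i] j].
    have -> : i = ord0 by apply: val_inj; case: i => -[].
    rewrite /= take0 drop_oversize ?size_tuple //.
    exact: (fvec_sub (fun (j : 'I_(\dim U)) (v : 2.-tuple 'I_n) => gcoef [::] [::] (vfam j)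
      v)).
  by move=> j; apply: gcoef_sub (mem_vfam j); apply: span_vfam.
rewrite /ideal_rank UF; apply/eqP; move: freeF; rewrite /row_free => /eqP->.
by rewrite card_ord.
Qed.

Lemma has_dim_lt2 U d : (d < 2)%N -> has_dim U d (n ^ d).
Proof. by move=> d2; apply/has_dimE; rewrite ideal_rank_lt2 // addn0. Qed.

End BuiltIn.

Section PrimeField.

Lemma Fp_prime_field p : prime p -> is_prime_field 'F_p.
Proof.
move=> p_pr x; exists (val x : int), 1; rewrite oner_eq0 divr1; split=> //.
by rewrite -[RHS]/((val x)%:R) natr_Zp.
Qed.

Definition big_field (k0 : fieldType) N : fieldType := {fraction (mpoly N k0)}.

Definition big_field_inj (k0 : fieldType) N : {rmorphism k0 -> big_field k0 N} :=
  @FracField.tofrac (mpoly N k0) \o @mpolyC N k0.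

Lemma trdeg_big_field (k0 : fieldType) M N : (M <= N)%N ->
  trdeg_ge (big_field_inj k0 N) M.
Proof.
move=> MN; pose X (i : 'I_M) : mpoly N k0 := 'X_(widen_ord MN i).
exists (fun i => FracField.tofrac (X i)) => p.
have -> : mpoly.mmap (big_field_inj k0 N) (fun i => FracField.tofrac (X i)) p =
    FracField.tofrac (mpoly.mmap (@mpolyC N k0) X p).
  rewrite /mpoly.mmap rmorph_sum; apply: eq_bigr => m _.
  by rewrite rmorphM; congr (_ * _); rewrite /mmap1 rmorph_prod; apply: eq_bigr => i _;
    rewrite rmorphXn.
move=> /eqP; rewrite tofrac_eq0 => /eqP p0.
(* [Y] sends the first [M] indeterminates back and the others to 0, which undoes [X]. *)
pose Y (j : 'I_N) : mpoly M k0 := if insub (val j) is Some i then 'X_i else 0.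
have : mpoly.mmap (@mpolyC M k0) Y (mpoly.mmap (@mpolyC N k0) X p) = 0.
  by rewrite p0 raddf0.
move=> <-; rewrite [LHS]mpolyE {2}/mpoly.mmap rmorph_sum; apply: eq_bigr => m _.
rewrite rmorphM /= mmapC mul_mpolyC; congr (_ *: _).
rewrite /mmap1 rmorph_prod /= mpolyXE_id; apply: eq_bigr => i _.
rewrite rmorphXn /= /X mmapX mmap1U /Y; congr (_ ^+ _).
by rewrite insubT //= => lt_iM; congr 'X_ _; apply: val_inj.
Qed.

End PrimeField.

(** * Algebras with few nonzero components *)

Section Congruences.
Variables (k : fieldType) (n : nat) (U : {vspace 'M[k]_n}).
Local Notation freeAlg := (freeAlg k n).
Implicit Types (f g h : freeAlg) (u v w : seq 'I_n).

Lemma ideal_trans g f h :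
  in_ideal U (f - g) -> in_ideal U (g - h) -> in_ideal U (f - h).
Proof. by move=> fg gh; rewrite -(subrKA g f (- h)); apply: idealD. Qed.

Lemma ideal_subD f f' g g' :
  in_ideal U (f - f') -> in_ideal U (g - g') -> in_ideal U (f + g - (f' + g')).
Proof. by move=> ff' gg'; rewrite opprD addrACA; apply: idealD. Qed.

Lemma ideal_word_cat u w w' v : in_ideal U (word k w - word k w') ->
  in_ideal U (word k (u ++ w ++ v) - word k (u ++ w' ++ v)).
Proof.
move=> ww'; rewrite !word_cat -mulrBr -mulrBl mulrA; exact: ideal_mul.
Qed.

Lemma ideal_word0_cat u w v : in_ideal U (word k w) ->
  in_ideal U (word k (u ++ w ++ v)).
Proof. by move=> w0; rewrite !word_cat mulrA; apply: ideal_mul. Qed.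

Lemma ideal_delta2 a b : delta_mx a b \in U -> in_ideal U (word k [:: a; b]).
Proof. by move=> /ideal_qform; rewrite qform_delta. Qed.

Hypothesis commU : (built_in k Commutative n <= U)%VS.

Lemma ideal_swap a b : in_ideal U (word k [:: a; b] - word k [:: b; a]).
Proof.
rewrite -!qform_delta -linearB; apply/ideal_qform/(subvP commU)/memv_span.
by apply/mapP; exists (a, b); rewrite ?mem_enum.
Qed.

(** Induction on the word: [mid] carries the head letter through the prefix that precedes it in
    [w']. *)
Lemma ideal_perm w w' : perm_eq w w' -> in_ideal U (word k w - word k w').
Proof.
have mid a p : in_ideal U (word k (a :: p) - word k (rcons p a)).
  elim: p => [|b p IHp]; first by rewrite subrr; apply: ideal0.
  apply: (@ideal_trans (word k (b :: a :: p)));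
    first exact: (ideal_word_cat [::] p (ideal_swap a b)).
  by have := ideal_word_cat [:: b] [::] IHp; rewrite !cats0.
elim: w w' => [|a w IHw] w' ww'.
  move: ww'; rewrite perm_sym => /perm_nilP->.
  by rewrite subrr; apply: ideal0.
have aw' : a \in w' by rewrite -(perm_mem ww') mem_head.
case/splitPr: aw' ww' => p1 p2;
  rewrite perm_sym perm_catC /= perm_cons perm_catC perm_sym => /IHw ww'.
apply: (@ideal_trans (word k (a :: p1 ++ p2))).
  by have := ideal_word_cat [:: a] [::] ww'; rewrite !cats0.
by have := ideal_word_cat [::] p2 (mid a p1); rewrite /= cat_rcons.
Qed.

End Congruences.

Section DualOfSpan.
Variables (k : fieldType) (n : nat).

Lemma mem_koszul_dual_span (J : finType) (fam : J -> 'M[k]_n) M :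
  (forall j, pairing (fam j) M = 0) ->
  M \in koszul_dual <<[seq fam j | j : J]>>%VS.
Proof.
move=> fam0; apply/koszul_dualP => A /(mem_famP (erefl _))[c ->].
rewrite pairingC linear_sum big1 // => j _.
by rewrite linearZ /= -[X in _ *: X]pairingC fam0 scaler0.
Qed.

Lemma pairing_delta (A : 'M[k]_n) a b : pairing A (delta_mx a b) = A a b.
Proof.
rewrite /pairing (bigD1 a) // -[RHS]addr0; congr (_ + _); last first.
  rewrite big1 // => i /negPf ia; rewrite big1 // => j _.
  by rewrite mxE ia mulr0.
rewrite (bigD1 b) // -[RHS]addr0; congr (_ + _); first by rewrite mxE !eqxx mulr1.
by rewrite big1 // => j /negPf jb; rewrite mxE jb andbF mulr0.
Qed.

(** Pairing a symmetric matrix with a commutator subtracts two equal entries. *)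
Lemma built_in_sub_dual (U : {vspace 'M[k]_n}) :
  (forall M, M \in U -> M^T = M) -> (built_in k Commutative n <= koszul_dual U)%VS.
Proof.
move=> symU; apply/span_subvP => M /mapP[p _ ->]; apply/koszul_dualP => A /symU At.
by rewrite linearB /= !pairing_delta -{2}At mxE subrr.
Qed.

Lemma sym_span (J : finType) (fam : J -> 'M[k]_n) M :
  (forall j, (fam j)^T = fam j) -> M \in <<[seq fam j | j : J]>>%VS -> M^T = M.
Proof.
move=> symf /(mem_famP (erefl _))[c ->].
by rewrite linear_sum; apply: eq_bigr => j _; rewrite linearZ /= symf.
Qed.

End DualOfSpan.

Definition dim_predefined (C : qclass) n := if C is Commutative then 'C(n, 2) else 0%N.

Lemma dim_built_inE (k : fieldType) C n : \dim (built_in k C n) = dim_predefined C n.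
Proof. by case: C; rewrite ?dim_built_in ?dimv0. Qed.

Lemma dim_rel_space (k : fieldType) C n r (c : 'I_r -> mon2 C n -> k) :
  (\dim (rel_space c) <= r + dim_predefined C n)%N.
Proof.
apply: leq_trans (dimv_add_leqif _ _) _; rewrite dim_built_inE leq_add2r.
by apply: leq_trans (dim_span _) _; rewrite size_map -cardE card_ord.
Qed.

(** If an algebra over [k0] vanishes in degree 3, semicontinuity makes [A_t] vanish from degree 3
    on; degrees 0 and 1 carry no relation. In degree 2 semicontinuity bounds the generic dimension
    above, and the number of relations bounds it below. *)
Lemma generic_short (k0 k : fieldType) C n r
    (U0 : {vspace 'M[k0]_n}) (U : {vspace 'M[k]_n}) :
    of_type C r U0 -> of_type C r U ->
    \dim U0 = (r + dim_predefined C n)%N -> \dim U = (r + dim_predefined C n)%N ->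
    (forall w, size w = 3 -> in_ideal U0 (word k0 w)) ->
    (forall w, size w = 3 -> in_ideal U (word k w)) ->
  generic k0 C r U.
Proof.
move=> [c0 [_ U0E]] typeU dU0 dU U0_3 U_3; split=> // d.
have dim0 (F : fieldType) (V : {vspace 'M[F]_n}) : (2 < d)%N ->
    (forall w, size w = 3 -> in_ideal V (word F w)) -> forall m, has_dim V d m -> m = 0%N.
  move=> d2 V3 m /(@has_dim_le_span _ _ _ _ _ _ (fun i : 'I_0 => 0)).
  rewrite card_ord leqn0 => h; apply/eqP/h => w; exists (fun=> 0).
  rewrite big_ord0 subr0 -(cat_take_drop 3 w) word_cat; apply/ideal_mulr/V3.
  by rewrite size_takel // size_tuple.
have [m gm] := has_dim_exists (generic_rel k0 C n r) d.
have [m0 U0m] := has_dim_exists U0 d; have [mU Um] := has_dim_exists U d.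
have mm0 : (m <= m0)%N by move: (U0m); rewrite U0E; apply: has_dim_specialize gm.
case: (ltngtP d 2) => d2.
- by exists (n ^ d)%N; split; apply: has_dim_lt2.
- exists 0%N; rewrite -{1}(dim0 _ _ d2 U_3 _ Um); split=> //.
  by move: mm0 gm; rewrite (dim0 _ _ d2 U0_3 _ U0m) leqn0 => /eqP->.
exists m; split=> //; suff -> : m = mU by [].
move: gm U0m Um; rewrite d2 => /has_dimE gm /has_dimE U0m /has_dimE Um.
rewrite !ideal_rank2 in gm U0m Um.
have := dim_rel_space (@indet_coef k0 C n r); rewrite -/(generic_rel k0 C n r).
move: gm U0m Um; rewrite dU0 dU => gm U0m Um dg.
apply: (@addIn (r + dim_predefined C n)); rewrite Um; apply/eqP.
rewrite eqn_leq -{1}U0m leq_add2r mm0 -gm leq_add2l.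
exact: dg.
Qed.

Lemma tuple4_ind (T : Type) (P : 4.-tuple T -> Prop) :
  (forall a b c d, P [tuple a; b; c; d]) -> forall t, P t.
Proof.
move=> Pabcd [[|a [|b [|c [|d [|//]]]]] // t4].
by rewrite (_ : Tuple t4 = [tuple a; b; c; d]); [|apply: val_inj].
Qed.

Section ExtraSyzygy.
Variables (k : fieldType) (n : nat) (J : finType) (fam : J -> 'M[k]_n).
Variable l : J -> 'I_n * 'I_n.
Hypothesis famE : forall i j, fam i (l j).1 (l j).2 = (i == j)%:R.
Local Notation W := (4.-tuple 'I_n).

Lemma gcoef_cat (R : nzRingType) u u' w w' (M : 'M[R]_n) x y : size u = size u' ->
  gcoef u w M (u' ++ [:: x, y & w']) = M x y * ((u' == u) && (w' == w))%:R.
Proof.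
move=> uu'; rewrite /gcoef (bigD1 x) // -[RHS]addr0; congr (_ + _); last first.
  rewrite big1 // => a ax; rewrite big1 // => b _.
  by rewrite eqseq_cat // !eqseq_cons [x == a]eq_sym (negPf ax) andbF mulr0.
rewrite (bigD1 y) // -[RHS]addr0; congr (_ + _).
  by rewrite eqseq_cat // !eqseq_cons !eqxx.
rewrite big1 // => b yb.
by rewrite eqseq_cat // !eqseq_cons [y == b]eq_sym (negPf yb) /= !andbF mulr0.
Qed.

Definition relL (x : J * ('I_n * 'I_n)) (v : W) : k :=
  gcoef [::] [:: x.2.1; x.2.2] (fam x.1) v.
Definition relM (x : J * ('I_n * 'I_n)) (v : W) : k :=
  gcoef [:: x.2.1] [:: x.2.2] (fam x.1) v.
Definition relR (x : J * ('I_n * 'I_n)) (v : W) : k :=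
  gcoef [:: x.2.1; x.2.2] [::] (fam x.1) v.

(* With R the space of relations and V that of generators, the ideal in degree 4
   is R V V + V R V + V V R, and R R lies in both R V V and V V R. *)
Lemma has_dim4_ge m (z : W -> k) :
    (exists v, z v != 0) -> (fvec z <= fmx relM)%MS ->
    (fvec z <= fmx relL + fmx relR)%MS ->
  has_dim <<[seq fam j | j : J]>> 4 m ->
  (n ^ 4 + #|J| ^ 2 + 1 <= m + 3 * (#|J| * n ^ 2))%N.
Proof.
move=> [v0 zv0] zM zLR /(has_dimP _ (erefl _)) mE.
pose RR (x : J * J) (v : W) := fam x.1 (tnth v 0) (tnth v 1) *
  fam x.2 (tnth v 2%:R) (tnth v 3%:R).
have RR_L : (fmx RR <= fmx relL)%MS.
  apply/fmx_subP => -[i j].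
  rewrite (_ : fvec (RR (i, j)) = \sum_p fam j p.1 p.2 *: fvec (relL (i, p))).
    by apply: summx_sub => p _; apply/scalemx_sub/fvec_sub.
  under [RHS]eq_bigr do rewrite -fvecZ.
  rewrite -fvec_sum; apply: eq_fvec; elim/tuple4_ind => a b c d.
  rewrite (bigD1 (c, d)) // -[LHS]addr0; congr (_ + _).
    by rewrite /RR !(tnth_nth a) /relL (@gcoef_cat _ [::] [::] _ [:: c;
      d]) //= !eqxx mulr1 mulrC.
  rewrite big1 // => -[c' d'] /negPf cd.
  rewrite /relL (@gcoef_cat _ [::] [::] _ [:: c; d]) // !eqseq_cons andbT.
  by move: cd; rewrite eq_sym xpair_eqE => /= ->; rewrite !mulr0.
have RR_R : (fmx RR <= fmx relR)%MS.
  apply/fmx_subP => -[i j].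
  rewrite (_ : fvec (RR (i, j)) = \sum_p fam i p.1 p.2 *: fvec (relR (j, p))).
    by apply: summx_sub => p _; apply/scalemx_sub/fvec_sub.
  under [RHS]eq_bigr do rewrite -fvecZ.
  rewrite -fvec_sum; apply: eq_fvec; elim/tuple4_ind => a b c d.
  rewrite (bigD1 (a, b)) // -[LHS]addr0; congr (_ + _).
    by rewrite /RR !(tnth_nth a) /relR (@gcoef_cat _ [:: a; b] [:: a;
      b] _ [::]) //= !eqxx mulr1.
  rewrite big1 // => -[a' b'] /negPf ab.
  rewrite /relR (@gcoef_cat _ [:: a'; b'] [:: a; b] _ [::]) // !eqseq_cons !andbT.
  by move: ab; rewrite eq_sym xpair_eqE => /= ->; rewrite !mulr0.
(* Products of two relations are independent: the coefficient at the product of two leading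
   monomials isolates one of them. *)
have rRR : \rank (fmx RR) = (#|J| ^ 2)%N.
  rewrite -mulnn -card_prod; apply/eqP.
  rewrite -[_ == _]/(row_free _) -kermx_eq0; apply/eqP/row_matrixP => i; rewrite row0.
  set c := row i _; have: c *m fmx RR = 0 by rewrite -row_mul mulmx_ker row0.
  rewrite mulmx_sum_row => c0; apply/rowP => x; rewrite [RHS]mxE.
  pose p := (enum_val x).1; pose q := (enum_val x).2.
  have := congr1 (fun r : 'rV__ => r 0 (enum_rank [tuple (l p).1; (l p).2; (l q).1;
    (l q).2])) c0.
  rewrite summxE [in RHS]mxE (bigD1 x) //= big1 => [|y yx].
    by rewrite !mxE enum_rankK /RR /tnth /= !famE !eqxx !mulr1 addr0.
  rewrite !mxE enum_rankK /RR /tnth /= !famE -natrM mulnb.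
  have -> : ((enum_val y).1 == p) && ((enum_val y).2 == q) = (enum_val y == enum_val x).
    by rewrite -pair_eqE.
  by rewrite (inj_eq enum_val_inj) (negPf yx) mulr0.
have IS : (ideal_mx 4 fam <= (fmx relL + fmx relR) + fmx relM)%MS.
  apply/fmx_subP => -[[t i] j].
  elim/tuple4_ind: t => a b c d; case: i => -[|[|[|//]]] i4.
  - by apply: submx_trans (fvec_sub relL (j, (c, d))) _; rewrite -addsmxA addsmxSl.
  - by apply: submx_trans (fvec_sub relM (j, (a, d))) _; rewrite addsmxSr.
  apply: submx_trans (fvec_sub relR (j, (a, b))) _.
  exact: submx_trans (addsmxSr _ _) (addsmxSl _ _).
have rle f : (\rank (fmx f : 'M[k]_(#|{: J * ('I_n * 'I_n)}|, #|{: W}|)) <= #|J| * n ^ 2)%N.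
  by apply: leq_trans (rank_leq_row _) _; rewrite !card_prod card_ord mulnn.
(* The vector [z] is the additional dependency, lying in both spaces. *)
have z1 : (0 < \rank ((fmx relL + fmx relR) :&: fmx relM)%MS)%N.
  apply: leq_trans (mxrankS (_ : (fvec z <= _)%MS)); last by rewrite sub_capmx zLR.
  rewrite rank_rV lt0b; apply: contra_neq zv0 => z0.
  by apply: (@fvec_inj _ _ z (fun=> 0)); rewrite z0 fvec0.
have := mxrank_sum_cap (fmx relL + fmx relR)%MS (fmx relM).
have := mxrank_sum_cap (fmx relL) (fmx relR).
have := mxrankS IS; rewrite -(leq_add2l m) mE.
have : (#|J| ^ 2 <= \rank (fmx relL :&: fmx relR)%MS)%N.
  by rewrite -rRR mxrankS // sub_capmx RR_L.
(* Two dimension formulas for sums: the overlaps [R R] and [z] push the rank below the row count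
   [3 * p]. *)
have arith (a b c i s t u p q r m' : nat) : (a <= p -> b <= p -> c <= p -> 0 < i ->
    q <= s -> r <= m' + t -> u + s = a + c -> t + i = u + b ->
    r + q + 1 <= m' + 3 * p)%N by lia.
exact: arith (rle relL) (rle relM) (rle relR) z1.
Qed.

End ExtraSyzygy.

(** * Parts (a) and (b) *)

Definition acomm (R : nzRingType) n (i j : 'I_n) : 'M[R]_n :=
  delta_mx i j + delta_mx j i.

Lemma acomm_sym (R : nzRingType) n (i j : 'I_n) : (acomm R i j)^T = acomm R i j.
Proof. by rewrite linearD /= !trmx_delta addrC. Qed.

Lemma gcoef_delta (R : nzRingType) n u w (i j : 'I_n) v :
  gcoef u w (delta_mx i j : 'M[R]_n) v = (v == u ++ [:: i, j & w])%:R.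
Proof.
rewrite /gcoef (bigD1 i) // -[RHS]addr0; congr (_ + _); last first.
  rewrite big1 // => i' /negPf ii'; rewrite big1 // => j' _.
  by rewrite mxE ii' mul0r.
rewrite (bigD1 j) // -[RHS]addr0; congr (_ + _); first by rewrite mxE !eqxx mul1r.
by rewrite big1 // => j' /negPf jj'; rewrite mxE jj' andbF mul0r.
Qed.

Lemma gcoefD (R : nzRingType) n u w (M N : 'M[R]_n) v :
  gcoef u w (M + N) v = gcoef u w M v + gcoef u w N v.
Proof.
rewrite /gcoef -big_split; apply: eq_bigr => i _; rewrite -big_split.
by apply: eq_bigr => j _; rewrite mxE mulrDl.
Qed.

Lemma oppr_char2 (R : nzRingType) (x : R) : 2%:R = 0 :> R -> - x = x.
Proof.
by move=> two0; apply/eqP; rewrite eq_sym -addr_eq0 -mulr2n -mulr_natr two0 mulr0.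
Qed.

Definition o0 : 'I_4 := @Ordinal 4 0 isT.
Definition o1 : 'I_4 := @Ordinal 4 1 isT.
Definition o2 : 'I_4 := @Ordinal 4 2 isT.
Definition o3 : 'I_4 := @Ordinal 4 3 isT.

Lemma ord4P (P : 'I_4 -> Prop) : P o0 -> P o1 -> P o2 -> P o3 -> forall i, P i.
Proof.
move=> P0 P1 P2 P3 [[|[|[|[|//]]]] i4].
- by rewrite (_ : Ordinal i4 = o0) //; apply: val_inj.
- by rewrite (_ : Ordinal i4 = o1) //; apply: val_inj.
- by rewrite (_ : Ordinal i4 = o2) //; apply: val_inj.
by rewrite (_ : Ordinal i4 = o3) //; apply: val_inj.
Qed.

(** * The algebra with a Jacobi syzygy, and its dual, zero in degree 3 *)

Section SyzygyExample.
Variable k : fieldType.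

Definition syz_rel (j : 'I_4) : 'M[k]_4 :=
  match val j with
  | 0 => acomm k o0 o1
  | 1 => acomm k o0 o2
  | 2 => acomm k o1 o3
  | _ => delta_mx o2 o2 + delta_mx o3 o3
  end.

Definition syz_lead (j : 'I_4) : 'I_4 * 'I_4 :=
  match val j with 0 => (o0, o1) | 1 => (o0, o2) | 2 => (o1, o3) | _ => (o3, o3) end.

Definition syz_space := <<[seq syz_rel j | j : 'I_4]>>%VS.

Lemma syz_rel_lead i j : syz_rel i (syz_lead j).1 (syz_lead j).2 = (i == j)%:R.
Proof.
elim/ord4P: i; elim/ord4P: j; rewrite /syz_rel /syz_lead /acomm /= !mxE /= ?addr0 ?add0r //.
Qed.

Lemma syz_rel_sym j : (syz_rel j)^T = syz_rel j.
Proof.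
by elim/ord4P: j; rewrite /syz_rel /= ?acomm_sym // linearD /= !trmx_delta.
Qed.

Lemma dim_syz_space : \dim syz_space = 4.
Proof. by rewrite (dim_span_lead syz_rel_lead) card_ord. Qed.

Lemma sym_syz_space M : M \in syz_space -> M^T = M.
Proof. exact/sym_span/syz_rel_sym. Qed.

Definition syz_dual := koszul_dual syz_space.

Lemma dim_syz_dual : \dim syz_dual = 12.
Proof. by have := dim_koszul_dual syz_space; rewrite dim_syz_space => /(@addIn 4 _ 12). Qed.

Lemma syz_dual_comm : (built_in k Commutative 4 <= syz_dual)%VS.
Proof. exact/built_in_sub_dual/sym_syz_space. Qed.

(** The positions at which some [syz_rel] has a nonzero entry; the other products of two generators
    are relations of the dual. *)
Definition nz (a b : 'I_4) : bool :=
  (val a, val b) \in [:: (0, 1); (1, 0); (0, 2); (2, 0); (1, 3); (3, 1); (2, 2); (3, 3)]%N.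

Lemma syz_dual_word2 a b : ~~ nz a b -> in_ideal syz_dual (word k [:: a; b]).
Proof.
move=> ab; apply/ideal_delta2/mem_koszul_dual_span => j; rewrite pairing_delta.
by move: ab; elim/ord4P: a; elim/ord4P: b => //= _; elim/ord4P: j;
   rewrite /syz_rel /acomm /= !mxE /= ?addr0.
Qed.

Lemma syz_dual_squares : in_ideal syz_dual (word k [:: o2; o2] - word k [:: o3; o3]).
Proof.
rewrite -!qform_delta -linearB; apply/ideal_qform/mem_koszul_dual_span => j.
rewrite linearB /= !pairing_delta.
by elim/ord4P: j; rewrite /syz_rel /acomm /= !mxE /= ?addr0 ?add0r ?oppr0 ?subrr.
Qed.

(** In a commutative algebra a cubic monomial vanishes as soon as two of its letters have product 0;
    only four monomials escape this test. *)
Lemma nz_triple a b c : [|| ~~ nz a b, ~~ nz b c, ~~ nz a c |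
  has (perm_eq [:: a; b; c])
    [:: [:: o0; o2; o2]; [:: o1; o3; o3]; [:: o2; o2; o2]; [:: o3; o3; o3]]].
Proof. by elim/ord4P: a; elim/ord4P: b; elim/ord4P: c. Qed.

(** The monomials that escape [nz_triple] vanish because x_2^2 = x_3^2 in the dual: each is x_a
    x_b^2 = x_a x_c^2 with {b, c} = {2, 3} and x_a x_c = 0. *)
Lemma syz_dual_word3 w : size w = 3 -> in_ideal syz_dual (word k w).
Proof.
have perm0 v v' : perm_eq v v' -> in_ideal syz_dual (word k v') -> in_ideal syz_dual (word k
  v).
  by move=> /(ideal_perm syz_dual_comm) vv' v'0; rewrite -(subrK (word k v') (word k v));
    apply: idealD.
have zero2 a b c : ~~ nz a b -> in_ideal syz_dual (word k [:: a; b; c]).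
  by move=> /syz_dual_word2; apply: (@ideal_word0_cat _ _ _ [::] [:: a; b] [:: c]).
have square a b c : (b, c) = (o2, o3) \/ (b, c) = (o3, o2) -> ~~ nz a c ->
    in_ideal syz_dual (word k [:: a; b; b]).
  move=> bc ac; rewrite -(subrK (word k [:: a; c; c]) (word k _)).
  apply: idealD; last exact: zero2.
  apply: (@ideal_word_cat _ _ _ [:: a] [:: b; b] [:: c; c] [::]).
  case: bc => -[-> ->]; first exact: syz_dual_squares.
  by rewrite -opprB; apply/idealN/syz_dual_squares.
case: w => [|a [|b [|c []]]] // _; case/or4P: (nz_triple a b c).
- exact: zero2.
- move/(zero2 b c a); apply: perm0.
  by rewrite (perm_catC [:: a] [:: b; c]).
- move/(zero2 a c b); apply: perm0.
  by rewrite perm_cons (perm_catC [:: b] [:: c]).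
case/hasP => v vin /perm0; apply; move: vin; rewrite !inE => /or4P[] /eqP->.
- by apply: (square _ _ o3); [left|].
- by apply: (square _ _ o2); [right|].
- by apply: (square _ _ o3); [left|].
by apply: (square _ _ o2); [right|].
Qed.

Lemma syz_dual_comm_type : of_type Commutative 6 syz_dual.
Proof. by have := of_type_comm syz_dual_comm; rewrite dim_syz_dual. Qed.

Lemma syz_dual_noncomm_type : of_type NonCommutative 12 syz_dual.
Proof. by have := of_type_noncomm syz_dual; rewrite dim_syz_dual. Qed.

Lemma syz_dualK : koszul_dual syz_dual = syz_space.
Proof. exact: koszul_dualK. Qed.

Lemma syz_space_lie_type : of_type LieType 4 syz_space.
Proof. by have := of_type_lie sym_syz_space; rewrite dim_syz_space. Qed.

Lemma syz_space_noncomm_type : of_type NonCommutative 4 syz_space.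
Proof. by have := of_type_noncomm syz_space; rewrite dim_syz_space. Qed.

Hypothesis two0 : 2%:R = 0 :> k.

(* Write r0 = [x0, x1], r1 = [x0, x2], r2 = [x1, x3], r3 = x2^2 + x3^2. Then
   [x0, x3^2] = [r1, x2] + [x0, r3] and [x1, x3^2] = [r2, x3], so that the Jacobi
   identity [x1, [x0, x3^2]] + [x0, [x1, x3^2]] = [r0, x3^2] (in characteristic 2)
   is a linear relation between the elements x_a x_b r_j, x_a r_j x_b and
   r_j x_a x_b. Its terms of the form x_a r_j x_b are collected in syzM. *)
Definition syzM := [:: (o1, (o1, o2)); (o1, (o2, o1)); (o3, (o1, o0));
  (o3, (o0, o1)); (o2, (o0, o3)); (o2, (o3, o0))].
Definition syzL := [:: (o1, (o2, o1)); (o3, (o0, o1)); (o2, (o3, o0)); (o0, (o3, o3))].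
Definition syzR := [:: (o1, (o1, o2)); (o3, (o1, o0)); (o2, (o0, o3)); (o0, (o3, o3))].

Lemma jacobi_syzygy (v : 4.-tuple 'I_4) :
  \sum_(x <- syzM) relM syz_rel x v =
  \sum_(x <- syzL) relL syz_rel x v + \sum_(x <- syzR) relR syz_rel x v.
Proof.
have [t tE] : exists t : seq 'I_4 -> k,
    forall u w i j, gcoef u w (delta_mx i j) v = t (u ++ [:: i, j & w]).
  by exists (fun w => (val v == w)%:R) => u w i j; rewrite gcoef_delta.
rewrite /syzM /syzL /syzR !big_cons !big_nil /relM /relL /relR /syz_rel /acomm /=.
rewrite !gcoefD !tE /= !addr0.
(* The words x_1 x_0 x_3^2 and x_3^2 x_0 x_1 occur twice on the right; characteristic 2 removes
   them. *)
have extra0 : 2%:R * (t [:: o1; o0; o3; o3] + t [:: o3; o3; o0; o1]) = 0.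
  by rewrite two0 mul0r.
by rewrite -[LHS]addr0 -extra0; ring.
Qed.

(** Four relations in four variables: 256 + 16 + 1 - 3 * 64 = 81. *)
Lemma dim4_syz_space m : has_dim syz_space 4 m -> (81 <= m)%N.
Proof.
have zE : fvec (fun v : 4.-tuple 'I_4 => \sum_(x <- syzM) relM syz_rel x v) =
    \sum_(x <- syzM) fvec (relM syz_rel x) by rewrite fvec_sum.
have -> : (81 <= m)%N = (4 ^ 4 + #|'I_4| ^ 2 + 1 <= m + 3 * (#|'I_4| * 4 ^ 2))%N.
  by rewrite card_ord; lia.
move=> Lm.
apply: (has_dim4_ge syz_rel_lead (z := fun v => \sum_(x <- syzM) relM syz_rel x v)) => //.
(* This word occurs in exactly one term of [syzM], namely x_1 r1 x_2. *)
- exists [tuple o1; o0; o2; o2].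
  rewrite /syzM !big_cons big_nil /relM /syz_rel /acomm /= !gcoefD !gcoef_delta /=.
  by rewrite !addr0 ?add0r oner_eq0.
- by rewrite zE summx_sub // => x _; apply: fvec_sub.
rewrite (eq_fvec jacobi_syzygy) (_ : fvec _ =
  \sum_(x <- syzL) fvec (relL syz_rel x) + \sum_(x <- syzR) fvec (relR syz_rel x)).
  by apply: addmx_sub_adds; apply: summx_sub => x _; apply: fvec_sub.
by rewrite -!fvec_sum; apply/rowP => i; rewrite !mxE.
Qed.

End SyzygyExample.

(** * The tensor product of two free algebras, of dimension at most 80 in degree 4 *)

Section MonomialExample.
Variable k : fieldType.
Hypothesis two0 : 2%:R = 0 :> k.

Definition lo (p : bool) : 'I_4 := if p then o1 else o0.
Definition hi (p : bool) : 'I_4 := if p then o3 else o2.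

Definition tensor_rel (j : bool * bool) : 'M[k]_4 := acomm k (lo j.1) (hi j.2).
Definition tensor_space := <<[seq tensor_rel j | j : bool * bool]>>%VS.

Lemma dim_tensor_space : \dim tensor_space = 4.
Proof.
rewrite (dim_span_lead (l := fun j => (lo j.1, hi j.2))) ?card_prod ?card_bool //.
by move=> [[] []] [[] []]; rewrite /tensor_rel /acomm !mxE /= ?addr0.
Qed.

Lemma sym_tensor_space M : M \in tensor_space -> M^T = M.
Proof. by apply: sym_span => j; apply: acomm_sym. Qed.

Lemma tensor_space_swap p q : in_ideal tensor_space (word k [:: hi q;
  lo p] - word k [:: lo p; hi q]).
Proof.
rewrite -!qform_delta -linearB; apply: ideal_qform.
rewrite (_ : _ - _ = tensor_rel (p, q)); first exact: (fam_mem (erefl _)).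
have opp (M : 'M[k]_4) : - M = M by apply/matrixP => i j; rewrite mxE oppr_char2.
by rewrite opp addrC.
Qed.

(** Induction on the word: a new low letter joins the left block, and a new high letter is carried
    through that block by [move_hi]. *)
Lemma tensor_space_word w : exists s1 s2 : seq bool, (size s1 + size s2 = size w)%N /\
  in_ideal tensor_space (word k w - word k (map lo s1 ++ map hi s2)).
Proof.
have move_hi q s : in_ideal tensor_space (word k (hi q :: map lo s) - word k (rcons (map lo
  s) (hi q))).
  elim: s => [|p s IHs] /=; first by rewrite subrr; apply: ideal0.
  apply: (@ideal_trans _ _ _ (word k (lo p :: hi q :: map lo s))).
    exact: (ideal_word_cat [::] (map lo s) (tensor_space_swap p q)).
  by have := ideal_word_cat [:: lo p] [::] IHs; rewrite !cats0.
elim: w => [|i w [s1 [s2 [sz IHw]]]].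
  by exists [::], [::]; rewrite subrr; split; [|apply: ideal0].
have iw : in_ideal tensor_space (word k (i :: w) - word k (i :: map lo s1 ++ map hi s2)).
  by have := ideal_word_cat [:: i] [::] IHw; rewrite !cats0.
have [[p ip]|[q iq]] : (exists p, i = lo p) \/ (exists q, i = hi q).
  by elim/ord4P: i {iw}; [left; exists false|left; exists true|right; exists false|right;
    exists true].
  by exists (p :: s1), s2; rewrite /= -ip addSn sz.
exists s1, (q :: s2); rewrite addnS sz; split=> //; apply: ideal_trans iw _.
have := ideal_word_cat [::] (map hi s2) (move_hi q s1).
by rewrite /= cat_rcons iq.
Qed.

Lemma dim4_tensor_space m : has_dim tensor_space 4 m -> (m <= 80)%N.
Proof.
(* A normal form is given by the length of its left block, at most 4, and one bit for each letter: 5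
   * 16 = 80. *)
have -> : 80%N = #|{: 'I_5 * 4.-tuple bool}| by rewrite card_prod card_ord card_tuple
  card_bool.
pose e (x : 'I_5 * 4.-tuple bool) := word k (map lo (take x.1 x.2) ++ map hi (drop x.1 x.2)).
apply: (has_dim_le_span (e := e)) => w.
have [s1 [s2 [sz ws]]] := tensor_space_word w; rewrite size_tuple in sz.
have sz1 : (size s1 < 5)%N by rewrite ltnS -sz leq_addr.
have sz12 : size (s1 ++ s2) == 4 by rewrite size_cat sz.
pose x := (Ordinal sz1, Tuple sz12); exists (fun y => (y == x)%:R).
rewrite (bigD1 x) //= big1 => [|y /negPf->]; last by rewrite scale0r.
by rewrite eqxx scale1r addr0 /e /= take_size_cat // drop_size_cat.
Qed.

End MonomialExample.

(** * Part (c) *)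

Section SortedWords.
Variables (k : fieldType) (n : nat).
Local Notation P := (mpoly n k).
Hypothesis two0 : 2%:R = 0 :> k.
Implicit Types (i j : 'I_n) (w : seq 'I_n) (f : P).

Definition sorted_word (w : seq 'I_n) := sorted (fun i j : 'I_n => (i <= j)%N) w.

Lemma sorted_word_eq w w' :
  sorted_word w -> sorted_word w' -> perm_eq w w' -> w = w'.
Proof.
apply: sorted_eq => [j i l|i j]; first exact: leq_trans.
by move=> ij; apply/val_inj/anti_leq.
Qed.

Lemma mpoly_addrr (f : P) : f + f = 0.
Proof. by rewrite -mulr2n -scaler_nat two0 scale0r. Qed.

Lemma mderivU i j : ('X_j : P)^`M(i) = (i == j)%:R.
Proof.
rewrite mderivX mnm1E eq_sym; case: eqP => [->|_]; last by rewrite scale0r.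
by rewrite -{1}[U_(j)%MM]add0m addmK mpolyX0 scale1r.
Qed.

Lemma mderiv_sqr i (f : P) : (f ^+ 2)^`M(i) = 0.
Proof. by rewrite expr2 mderivM [f * _]mulrC mpoly_addrr. Qed.

(** The coefficient m (m - 1) of a second derivative is even. *)
Lemma mderiv2 i (f : P) : f^`M(i)^`M(i) = 0.
Proof.
rewrite [X in mderiv i X]/mderiv (linear_sum (mderiv i)) big1 // => m _.
rewrite [in LHS]/= mderivZ mderivX.
rewrite mnmBE mnm1E eqxx scalerA mulrAC -natrM subn1.
rewrite (_ : (m i * (m i).-1)%:R = 0 :> k) ?mul0r ?scale0r //.
have -> : (m i * (m i).-1 = 2 * 'C(m i, 2))%N.
  rewrite mul2n bin2 halfK oddM.
  by case: (m i) => // p; rewrite /= andNb subn0.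
by rewrite natrM two0 mul0r.
Qed.

Variable b : 'I_n -> 'I_n -> 'I_n -> k.

(** The value b_ij(y^2) prescribed for the anticommutator of x_i and x_j when [i < j]. *)
Definition square_comb i j : P := \sum_l b i j l *: 'X_l ^+ 2.

Lemma mderiv_square_comb i j a : (square_comb i j)^`M(a) = 0.
Proof. by rewrite raddf_sum big1 // => l _; rewrite /= mderivZ mderiv_sqr scaler0. Qed.

(** A derivation D_i. With the restriction to [j < i], each anticommutator receives its square part
    once, from the larger index. *)
Definition twist i (f : P) : P := \sum_(j < n | (j < i)%N) square_comb j i * f^`M(j).

Lemma twist_is_linear i : linear (twist i).
Proof.
move=> a f g; rewrite /twist scaler_sumr -big_split; apply: eq_bigr => j _.
by rewrite linearP mulrDr scalerAr.
Qed.
HB.instance Definition _ i := GRing.isLinear.Build k P P _ (twist i) (twist_is_linear i).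

Lemma twistM i f g : twist i (f * g) = twist i f * g + f * twist i g.
Proof.
rewrite /twist mulr_suml mulr_sumr -big_split; apply: eq_bigr => j _.
by rewrite mderivM /=; ring.
Qed.

Lemma twistU i j : twist i 'X_j = if (j < i)%N then square_comb j i else 0.
Proof.
rewrite /twist; case: ifP => ji.
  rewrite (bigD1 j) //= mderivU eqxx mulr1 big1 ?addr0 // => a /andP[_ /negPf aj].
  by rewrite mderivU aj mulr0.
rewrite big1 // => a ai; rewrite mderivU; case: eqP ai ji => [->->|_ _ _] //.
exact: mulr0.
Qed.

Lemma twist_twist i j f : twist i (twist j f) =
  \sum_(a < n | (a < i)%N) \sum_(c < n | (c < j)%N)
     square_comb a i * square_comb c j * f^`M(a)^`M(c).
Proof.
apply: eq_bigr => a _; rewrite /twist (linear_sum (mderiv a)) mulr_sumr;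
  apply: eq_bigr => c _ /=.
by rewrite mderivM mderiv_square_comb mul0r add0r mulrA mderiv_comm.
Qed.

(** The coefficients are combinations of squares, killed by every derivative, so the D_i commute as
    the partial derivatives do. *)
Lemma twistC i j f : twist i (twist j f) = twist j (twist i f).
Proof.
rewrite !twist_twist exchange_big; apply: eq_bigr => a _; apply: eq_bigr => c _.
by rewrite mderiv_comm [square_comb c i * _]mulrC.
Qed.

Lemma sum_sym_char2 (Q : pred 'I_n) (F : 'I_n -> 'I_n -> P) :
  (forall a c, F a c = F c a) -> (forall a, F a a = 0) ->
  \sum_(a | Q a) \sum_(c | Q c) F a c = 0.
Proof.
move=> symF F0; pose s := \sum_(a | Q a) \sum_(c | Q c && (a < c)%N) F a c.
suff -> : \sum_(a | Q a) \sum_(c | Q c) F a c = s + s by apply: mpoly_addrr.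
have sE : s = \sum_(a | Q a) \sum_(c | Q c && (c < a)%N) F a c.
  rewrite /s (exchange_big_dep Q) /=; last by move=> a c _ /andP[].
  apply: eq_bigr => a Qa; apply: eq_big => [c|c _]; last exact: symF.
  by rewrite Qa.
rewrite {2}sE -big_split; apply: eq_bigr => a Qa.
rewrite (bigID (fun c : 'I_n => (a < c)%N)); congr (_ + _).
rewrite (bigID (fun c : 'I_n => (c < a)%N)) /= [X in _ + X]big1 ?addr0.
  by apply: eq_bigl => c; rewrite -leqNgt; case: (Q c) => //=; case: ltngtP.
move=> c /andP[/andP[_]]; rewrite -!leqNgt => ca ac.
by rewrite (_ : c = a) ?F0 //; apply/val_inj/anti_leq; rewrite ca ac.
Qed.

(** The cross terms of D_i^2 cancel in equal pairs, and the diagonal ones contain a second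
    derivative in one variable. *)
Lemma twist2 i f : twist i (twist i f) = 0.
Proof.
rewrite twist_twist; apply: sum_sym_char2 => [a c|a].
  by rewrite mderiv_comm [square_comb a i * _]mulrC.
by rewrite mderiv2 mulr0.
Qed.

Definition act_gen i (f : P) : P := 'X_i * f + twist i f.

(** (y_i + D_i)^2 = y_i^2 + D_i(y_i) + 2 y_i D_i + D_i^2, where D_i(y_i) = 0 because D_i
    differentiates in smaller indices only. *)
Lemma act_gen_sqr i f : act_gen i (act_gen i f) = 'X_i ^+ 2 * f.
Proof.
rewrite /act_gen linearD /= twistM twistU ltnn mul0r add0r twist2 addr0.
by rewrite mulrDr -addrA mpoly_addrr addr0 mulrA expr2.
Qed.

(** The terms y_i y_j, y_i D_j, y_j D_i and D_i D_j occur twice; there remains D_j(y_i), while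
    D_i(y_j) = 0. *)
Lemma act_gen_acomm i j f : (i < j)%N ->
  act_gen i (act_gen j f) + act_gen j (act_gen i f) = square_comb i j * f.
Proof.
move=> ij; rewrite /act_gen !linearD /= !twistM !twistU ij ltnNge ltnW //= mul0r add0r.
rewrite [twist j (twist i f)]twistC.
rewrite -[RHS]addr0.
rewrite -(mpoly_addrr ('X_i * 'X_j * f + 'X_i * twist j f + 'X_j * twist i f + twist i (twist
  j f))).
ring.
Qed.

Lemma act_gen_is_linear i : linear (act_gen i).
Proof.
move=> a f g; rewrite /act_gen linearP mulrDr scalerDr -scalerAr.
by rewrite addrACA.
Qed.
HB.instance Definition _ i :=
  GRing.isLinear.Build k P P _ (act_gen i) (act_gen_is_linear i).

Fixpoint act_word w f : P := if w is i :: w' then act_gen i (act_word w' f) else f.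

Lemma act_word_is_linear w : linear (act_word w).
Proof. by elim: w => [//|i w IHw] a f g; rewrite /= IHw linearP. Qed.
HB.instance Definition _ w :=
  GRing.isLinear.Build k P P _ (act_word w) (act_word_is_linear w).

Lemma act_word_cat w w' f : act_word (w ++ w') f = act_word w (act_word w' f).
Proof. by elim: w => //= i w ->. Qed.

Lemma mderiv_prod_notin i w : i \notin w -> (\prod_(j <- w) 'X_j : P)^`M(i) = 0.
Proof.
elim: w => [|j w IHw]; first by rewrite big_nil -mpolyC1 mderivC.
rewrite inE negb_or => /andP[/negPf ij /IHw w0].
by rewrite big_cons mderivM w0 mulr0 addr0 mderivU ij mul0r.
Qed.

(** The first letter is minimal, so its derivation differentiates in variables absent from the rest
    of the word. *)
Lemma act_sorted_word w : sorted_word w -> act_word w 1 = \prod_(j <- w) 'X_j.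
Proof.
elim: w => [|i w IHw]; first by rewrite big_nil.
rewrite /sorted_word /= => sw; rewrite (IHw (path_sorted sw)) big_cons /act_gen.
rewrite [X in _ + X]big1 ?addr0 // => j ji.
rewrite mderiv_prod_notin ?mulr0 //; apply/negP => jw.
have tr : transitive (fun i j : 'I_n => (i <= j)%N) by move=> a c e; apply: leq_trans.
have /allP/(_ j jw) := order_path_min tr sw.
by rewrite leqNgt ji.
Qed.

Definition word_mon w : 'X_{1..n} := [multinom count_mem i w | i < n].

Lemma prod_word w : (\prod_(j <- w) 'X_j : P) = 'X_[word_mon w].
Proof.
elim: w => [|j w IHw].
  by rewrite big_nil -mpolyX0; congr 'X_[_]; apply/mnmP => i; rewrite mnmE mnm0E.
rewrite big_cons IHw -mpolyXD; congr 'X_[_]; apply/mnmP => i.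
by rewrite mnmDE mnm1E !mnmE.
Qed.

Lemma word_mon_inj w w' : sorted_word w -> sorted_word w' ->
  word_mon w = word_mon w' -> w = w'.
Proof.
move=> sw sw' ww'; apply: sorted_word_eq => //; apply/allP => i _ /=.
by have /mnmP/(_ i) := ww'; rewrite !mnmE => ->.
Qed.

(* x_i acts on k[y_1, ..., y_n] as y_i + sum_(j < i) b_ji(y^2) d/dy_j; in
   characteristic 2 this defines a module over every quadratic algebra whose
   relations follow from x_i x_j + x_j x_i = b_ij(x^2), i < j. *)
Lemma has_dim_ge_sorted (U : {vspace 'M[k]_n}) d m :
    (forall M, M \in U -> M^T = M) ->
    (forall M, M \in U -> forall l,
       M l l + \sum_(i < n) \sum_(j < n | (i < j)%N) M i j * b i j l = 0) ->
  has_dim U d m -> (#|[pred w : d.-tuple 'I_n | sorted_word w]| <= m)%N.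
Proof.
move=> symU relU; apply: (@has_dim_ge_free _ _ _ _ _ _ (fun w => act_word w 1)).
  move=> u w M MU; set f := act_word w 1.
  under eq_bigr do under eq_bigr do rewrite act_word_cat /= -/f -linearZ.
  under eq_bigr do rewrite -linear_sum.
  rewrite -linear_sum (_ : \sum_a _ = 0) ?linear0 //.
  (* By symmetry of [M] the terms at [(a, c)] and [(c, a)] combine into an anticommutator, and the
     diagonal ones are squares. *)
  have sumE : \sum_a \sum_c M a c *: act_gen a (act_gen c f) =
      \sum_l M l l *: ('X_l ^+ 2 * f) +
      \sum_(i < n) \sum_(j < n | (i < j)%N) M i j *: (square_comb i j * f).
    pose F a c := M a c *: act_gen a (act_gen c f).
    have FE (a c : 'I_n) : (a < c)%N -> F a c + F c a = M a c *: (square_comb a c * f).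
      move=> ac; rewrite /F (_ : M c a = M a c) -?scalerDr ?act_gen_acomm //.
      by rewrite -{1}(symU M MU) mxE.
    rewrite -[LHS]/(\sum_a \sum_c F a c).
    under [X in _ = _ + X]eq_bigr => a _ do under eq_bigr => c ac do rewrite -(FE _ _ ac).
    under [X in _ = _ + X]eq_bigr do rewrite big_split /=.
    rewrite big_split /= [X in _ = _ + (_ + X)](exchange_big_dep predT) //=.
    rewrite -!big_split /=; apply: eq_bigr => a _.
    rewrite (bigID (fun c : 'I_n => (a < c)%N)) /= addrCA; congr (_ + _).
    rewrite (bigD1 a) ?ltnn //= /F act_gen_sqr; congr (_ + _); apply: eq_bigl => c.
    by rewrite -leqNgt -val_eqE /=; case: ltngtP.
  rewrite sumE.
  have -> : \sum_(i < n) \sum_(j < n | (i < j)%N) M i j *: (square_comb i j * f) =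
      \sum_l (\sum_(i < n) \sum_(j < n | (i < j)%N) M i j * b i j l) *: ('X_l ^+ 2 * f).
    under [RHS]eq_bigr do rewrite scaler_suml.
    rewrite [RHS]exchange_big; apply: eq_bigr => i _.
    under [RHS]eq_bigr do rewrite scaler_suml.
    rewrite [RHS]exchange_big; apply: eq_bigr => j _.
    rewrite /square_comb mulr_suml scaler_sumr; apply: eq_bigr => l _.
    by rewrite -scalerAl scalerA.
  by rewrite -big_split big1 // => l _; rewrite /= -scalerDl relU // scale0r.
move=> c c0 w sw.
have := congr1 (fun f : P => f@_(word_mon w)) c0.
rewrite linear_sum (bigD1 w) //= big1 => [|w' /andP[sw' ww']].
  by rewrite mcoeffZ act_sorted_word // prod_word mcoeffX eqxx mulr1 addr0 mcoeff0.
rewrite mcoeffZ act_sorted_word // prod_word mcoeffX; case: eqP => [/word_mon_inj|_].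
  by move=> /(_ sw' sw)/val_inj ww; case/eqP: ww'.
by rewrite mulr0.
Qed.

End SortedWords.

Definition p0 : 'I_3 := @Ordinal 3 0 isT.
Definition p1 : 'I_3 := @Ordinal 3 1 isT.
Definition p2 : 'I_3 := @Ordinal 3 2 isT.

Lemma ord3P (P : 'I_3 -> Prop) : P p0 -> P p1 -> P p2 -> forall i, P i.
Proof.
move=> P0 P1 P2 [[|[|[|//]]] i3].
- by rewrite (_ : Ordinal i3 = p0) //; apply: val_inj.
- by rewrite (_ : Ordinal i3 = p1) //; apply: val_inj.
by rewrite (_ : Ordinal i3 = p2) //; apply: val_inj.
Qed.

Lemma sorted_word_nseq a b c :
  sorted_word (nseq a p0 ++ nseq b p1 ++ nseq c p2).
Proof.
have tr : transitive (fun i j : 'I_3 => (i <= j)%N) by move=> ? ? ?; apply: leq_trans.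
rewrite /sorted_word (sorted_pairwise tr) !pairwise_cat.
have pw m i : pairwise (fun i j : 'I_3 => (i <= j)%N) (nseq m i).
  by elim: m => //= m ->; rewrite andbT all_nseq leqnn orbT.
have ar m m' (i j : 'I_3) : (i <= j)%N ->
    allrel (fun i j : 'I_3 => (i <= j)%N) (nseq m i) (nseq m' j).
  by move=> ij; apply/allrelP => x y /nseqP[-> _] /nseqP[-> _].
by rewrite allrel_catr !pw !ar.
Qed.

Lemma sorted_wordE (w : seq 'I_3) : sorted_word w ->
  exists a b c, w = nseq a p0 ++ nseq b p1 ++ nseq c p2.
Proof.
move=> sw; exists (count_mem p0 w), (count_mem p1 w), (count_mem p2 w).
apply: sorted_word_eq => //; first exact: sorted_word_nseq.
apply/allP => i _ /=; rewrite !count_cat !count_nseq.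
by elim/ord3P: i => /=; rewrite ?mul1n ?mul0n ?addn0 ?add0n.
Qed.

Lemma cancel_pairs (V : zmodType) (a b c d e : V) : (forall x : V, x + x = 0) ->
  a + (e + (b + c) + (b + (a + (e + d)))) = c + d.
Proof.
move=> xx; rewrite (AC (1*((1*2)*(1*(1*2)))) ((1*6)*(3*5)*(2*7)*(4*8))).
by rewrite /= !xx !add0r.
Qed.

Lemma mul_sub_add (R : nzRingType) (f g x y z : R) :
  f * (x * g) - (f * (y * g) + f * (z * g)) = f * (x - (y + z)) * g.
Proof. by rewrite -mulrDr -mulrDl -mulrBr -mulrBl mulrA. Qed.

(** * Normal forms in the cyclic algebra, whose squares are central *)

Section CentralSquares.
Variable k : fieldType.
Hypothesis two0 : 2%:R = 0 :> k.

Definition nxt (l : 'I_3) : 'I_3 := match val l with 0 => p1 | 1 => p2 | _ => p0 end.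

Definition cyc_rel (l : 'I_3) : 'M[k]_3 := delta_mx l l + acomm k l (nxt l).
Definition cyc_space := <<[seq cyc_rel l | l : 'I_3]>>%VS.

Lemma dim_cyc_space : \dim cyc_space = 3.
Proof.
rewrite (dim_span_lead (l := fun l => (l, l))) ?card_ord // => i j.
by elim/ord3P: i; elim/ord3P: j; rewrite /cyc_rel /acomm !mxE /= ?addr0 ?add0r.
Qed.

Lemma sym_cyc_space M : M \in cyc_space -> M^T = M.
Proof. by apply: sym_span => l; rewrite linearD /= acomm_sym trmx_delta. Qed.

Local Notation I f := (in_ideal cyc_space f).
Local Notation wd := (word k).

Lemma freeAlg_oppr (f : freeAlg k 3) : - f = f.
Proof.
apply/eqP; rewrite eq_sym -addr_eq0 -mulr2n -scaler_nat two0 scale0r //.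
Qed.

Lemma freeAlg_addrr (f : freeAlg k 3) : f + f = 0.
Proof. by rewrite -{2}[f]freeAlg_oppr subrr. Qed.

Lemma cyc_space_rel l : I (wd [:: l; l] + (wd [:: l; nxt l] + wd [:: nxt l; l])).
Proof.
have := ideal_qform (fam_mem (erefl cyc_space) l).
have qformD A B : qform (A + B) = qform A + qform B :> freeAlg k 3 by apply: linearD.
by rewrite /cyc_rel /acomm 2!qformD !qform_delta.
Qed.

Lemma cyc_space_swap l : I (wd [:: nxt l; l] - (wd [:: l; nxt l] + wd [:: l; l])).
Proof.
have := cyc_space_rel l; move: (wd [:: l; l]) (wd [:: l; nxt l]) (wd [:: nxt l; l]) => A B C h.
by rewrite freeAlg_oppr addrC [B + A]addrC -addrA.
Qed.

Lemma cyc_space_swap_sqr l : I (wd [:: l; nxt l] - (wd [:: nxt l; l] + wd [:: l; l])).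
Proof.
have := cyc_space_rel l; move: (wd [:: l; l]) (wd [:: l; nxt l]) (wd [:: nxt l; l]) => A B C h.
by rewrite freeAlg_oppr addrA addrC addrA [A + B]addrC -addrA addrCA.
Qed.

(** With x = x_l and y its successor, the commutator of x with the relation x^2 + [x, y] is [x,
    [x, y]] = [x^2, y] in characteristic 2. *)
Lemma sqr_nxt l : I (wd [:: l; l; nxt l] - wd [:: nxt l; l; l]).
Proof.
have := idealD (ideal_mull (wd [:: l]) (cyc_space_rel l)) (ideal_mulr (wd [:: l])
  (cyc_space_rel l)).
rewrite !mulrDr !mulrDl -!word_cat /= freeAlg_oppr.
move: (wd [:: l; l; l]) (wd [:: l; l; nxt l]) (wd [:: l; nxt l; l]) (wd [:: nxt l; l;
  l]) => A B C D.
by rewrite addrACA freeAlg_addrr add0r -addrA [C + (C + D)]addrA freeAlg_addrr add0r.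
Qed.

(** The commutator of y with x^2 + [x, y] is [y, x^2] + [y^2, x], whose first summand is in the
    ideal by [sqr_nxt]. *)
Lemma nxt_sqr l : I (wd [:: nxt l; nxt l; l] - wd [:: l; nxt l; nxt l]).
Proof.
have := idealD (ideal_mull (wd [:: nxt l]) (cyc_space_rel l)) (ideal_mulr (wd [:: nxt l])
  (cyc_space_rel l)).
rewrite !mulrDr !mulrDl -!word_cat /= => /(idealD (sqr_nxt l)); rewrite !freeAlg_oppr.
move: (wd [:: l; l; nxt l]) (wd [:: nxt l; l; l]) (wd [:: nxt l; nxt l; l])
  (wd [:: l; nxt l; nxt l]) (wd [:: nxt l; l; nxt l]) => A B C D E.
rewrite [B + (E + C)]addrCA [D + E]addrC addrACA -addrA => h.
suff <- : A + (E + (B + C) + (B + (A + (E + D)))) = C + D by [].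
exact: cancel_pairs freeAlg_addrr.
Qed.

(** In a cycle of length 3, two distinct letters are neighbours in one order or the other. *)
Lemma sqr_comm i j : I (wd [:: i; i; j] - wd [:: j; i; i]).
Proof.
elim/ord3P: i; elim/ord3P: j; try by rewrite subrr; apply: ideal0.
- exact: (sqr_nxt p0).
- exact: (nxt_sqr p2).
- exact: (nxt_sqr p0).
- exact: (sqr_nxt p1).
- exact: (sqr_nxt p2).
exact: (nxt_sqr p1).
Qed.

Lemma sqr_comm_word i u v : I (wd (u ++ [:: i, i & v]) - wd ([:: i, i & u] ++ v)).
Proof.
elim: u => [|j u IHu] /=; first by rewrite subrr; apply: ideal0.
apply: (@ideal_trans _ _ _ (wd (j :: i :: i :: u ++ v))).
  by have := ideal_word_cat [:: j] [::] IHu; rewrite !cats0.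
rewrite -opprB; apply: idealN.
exact: (ideal_word_cat [::] (u ++ v) (sqr_comm i j)).
Qed.

Lemma even_power_comm i j m v :
  I (wd (j :: nseq m.*2 i ++ v) - wd (nseq m.*2 i ++ j :: v)).
Proof.
elim: m => [|m IHm] /=; first by rewrite subrr; apply: ideal0.
apply: (@ideal_trans _ _ _ (wd (i :: i :: j :: nseq m.*2 i ++ v))).
  exact: (sqr_comm_word i [:: j] (nseq m.*2 i ++ v)).
by have := ideal_word_cat [:: i; i] [::] IHm; rewrite !cats0.
Qed.

Definition comb d (c : {w : d.-tuple 'I_3 | sorted_word w} -> k) : freeAlg k 3 :=
  \sum_x c x *: wd (val x).

Lemma combD d (c e : {w : d.-tuple 'I_3 | sorted_word w} -> k) :
  comb (fun x => c x + e x) = comb c + comb e :> freeAlg k 3.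
Proof. by rewrite -big_split; apply: eq_bigr => x _; rewrite scalerDl. Qed.

Lemma combZ d a (c : {w : d.-tuple 'I_3 | sorted_word w} -> k) :
  comb (fun x => a * c x) = a *: comb c.
Proof. by rewrite /comb scaler_sumr; apply: eq_bigr => x _; rewrite scalerA. Qed.

Definition in_sorted d (f : freeAlg k 3) :=
  exists c : {w : d.-tuple 'I_3 | sorted_word w} -> k, I (f - comb c).

Lemma in_sorted_trans d f g : I (f - g) -> in_sorted d g -> in_sorted d f.
Proof. by move=> fg [c gc]; exists c; apply: ideal_trans fg gc. Qed.

Lemma in_sortedD d f g : in_sorted d f -> in_sorted d g -> in_sorted d (f + g).
Proof.
move=> [c fc] [e ge]; exists (fun x => c x + e x); rewrite combD.
by move: (comb c) (comb e) fc ge => f' g'; apply: ideal_subD.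
Qed.

Lemma in_sortedZ d a f : in_sorted d f -> in_sorted d (a *: f).
Proof.
move=> [c fc]; exists (fun x => a * c x); rewrite combZ.
by move: (comb c) fc => f' ff'; rewrite -scalerBr; apply: idealZ.
Qed.

Lemma in_sorted0 d : in_sorted d 0.
Proof.
exists (fun=> 0); rewrite /comb big1 ?subrr => [|x _]; first exact: ideal0.
exact: scale0r.
Qed.

Lemma in_sorted_word w : sorted_word w -> in_sorted (size w) (wd w).
Proof.
move=> sw; pose x : {t : (size w).-tuple 'I_3 | sorted_word t} := Sub (in_tuple w) sw.
exists (fun y => (y == x)%:R); rewrite /comb (bigD1 x) //= big1 => [|y /negPf->].
  by rewrite eqxx scale1r addr0 subrr; apply: ideal0.
exact: scale0r.
Qed.

Lemma in_sorted_nseq d a b c : d = (a + (b + c))%N ->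
  in_sorted d (wd (nseq a p0 ++ nseq b p1 ++ nseq c p2)).
Proof.
move=> ->; have := in_sorted_word (sorted_word_nseq a b c).
by rewrite !size_cat !size_nseq.
Qed.

Lemma odd_halfS a : odd a -> a = (a./2.*2).+1.
Proof. by move=> oa; rewrite -{1}[a]odd_double_half oa. Qed.

Lemma even_half a : ~~ odd a -> a = a./2.*2.
Proof. by move=> ea; rewrite -{1}[a]odd_double_half (negPf ea). Qed.

Lemma in_sorted_rewrite d u v x y z :
    I (wd x - (wd y + wd z)) ->
    in_sorted d (wd (u ++ y ++ v)) -> in_sorted d (wd (u ++ z ++ v)) ->
  in_sorted d (wd (u ++ x ++ v)).
Proof.
move=> xyz sy sz; apply: in_sorted_trans (in_sortedD sy sz).
rewrite !word_cat; move: (wd u) (wd v) (wd x) (wd y) (wd z) xyz => f g X Y Z XYZ.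
have -> : f * (X * g) - (f * (Y * g) + f * (Z * g)) = f * (X - (Y + Z)) * g.
  exact: mul_sub_add.
exact: ideal_mul.
Qed.

Lemma cat_nseqS (T : Type) m (x : T) s : nseq m x ++ x :: s = nseq m.+1 x ++ s.
Proof. by elim: m => //= m ->. Qed.

Lemma in_sorted_even d u v i j m : in_sorted d (wd (u ++ nseq m.*2 i ++ j :: v)) ->
  in_sorted d (wd (u ++ j :: nseq m.*2 i ++ v)).
Proof.
apply: in_sorted_trans.
by have := ideal_word_cat u [::] (even_power_comm i j m v); rewrite !cats0.
Qed.

(** An even power of x_1 commutes with x_2; for an odd one a single exchange x_2 x_1 = x_1 x_2 +
    x_1^2 remains. *)
Lemma in_sorted_2 d a b c : d = (a + (b + c)).+1 ->
  in_sorted d (wd (nseq a p0 ++ p2 :: nseq b p1 ++ nseq c p2)).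
Proof.
move=> dE; have [ob|eb] := boolP (odd b).
  rewrite (odd_halfS ob) -cat_nseqS; apply: in_sorted_even; rewrite catA.
  apply: (in_sorted_rewrite (x := [:: p2; p1]) (cyc_space_swap p1));
    rewrite /= -catA cat_nseqS.
    by rewrite -(odd_halfS ob); apply: (@in_sorted_nseq d a b c.+1); rewrite dE; lia.
  by rewrite cat_nseqS -(odd_halfS ob); apply: (@in_sorted_nseq d a b.+1 c); rewrite dE; lia.
rewrite {1}(even_half eb); apply: in_sorted_even; rewrite -(even_half eb).
by apply: (@in_sorted_nseq d a b c.+1); rewrite dE; lia.
Qed.

(** The new letter passes the even part of the power of x_0. A remaining factor x_0 is exchanged by
    x_1 x_0 = x_0 x_1 + x_0^2, or by x_2 x_0 = x_0 x_2 + x_2^2, whose central square moves to the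
    right. *)
Lemma in_sorted_cons d i w : sorted_word w -> size w = d -> in_sorted d.+1 (wd (i :: w)).
Proof.
move=> /sorted_wordE[a [b [c ->]]]; rewrite !size_cat !size_nseq => dE.
have push j : in_sorted d.+1 (wd (nseq (a./2.*2) p0 ++ j :: nseq (odd a) p0 ++ nseq b p1 ++
  nseq c p2)) ->
    in_sorted d.+1 (wd (j :: nseq a p0 ++ nseq b p1 ++ nseq c p2)).
  rewrite -{3}[a]odd_double_half addnC nseqD -catA.
  exact: (@in_sorted_even _ [::]).
elim/ord3P: i.
- by apply: (@in_sorted_nseq d.+1 a.+1 b c); rewrite -dE; lia.
- apply: push; have [oa|ea] := boolP (odd a); rewrite /=.
    apply: (in_sorted_rewrite (x := [:: p1; p0]) (cyc_space_swap p0)); rewrite /= cat_nseqS.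
      by rewrite -(odd_halfS oa); apply: (@in_sorted_nseq d.+1 a b.+1 c); rewrite -dE; lia.
    by rewrite cat_nseqS -(odd_halfS oa); apply: (@in_sorted_nseq d.+1 a.+1 b c);
      rewrite -dE; lia.
  by rewrite -(even_half ea); apply: (@in_sorted_nseq d.+1 a b.+1 c); rewrite -dE; lia.
apply: push; have [oa|ea] := boolP (odd a); rewrite /=; last first.
  by rewrite -(even_half ea); apply: in_sorted_2; rewrite -dE.
apply: (in_sorted_rewrite (x := [:: p2; p0]) (cyc_space_swap_sqr p2)); rewrite /=.
  by rewrite cat_nseqS -(odd_halfS oa); apply: in_sorted_2; rewrite -dE.
apply: (@in_sorted_trans _ _ (wd (nseq a./2.*2 p0 ++ nseq b p1 ++ [:: p2, p2 & nseq c p2]))).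
  have := ideal_word_cat (nseq a./2.*2 p0) [::] (sqr_comm_word p2 (nseq b p1) (nseq c p2)).
  by rewrite !cats0 => /idealN; rewrite opprB.
apply: (@in_sorted_nseq d.+1 a./2.*2 b c.+2).
by rewrite -dE; have := odd_double_half a; rewrite oa; lia.
Qed.

Lemma in_sorted_all w : in_sorted (size w) (wd w).
Proof.
elim: w => [|i w [c wc]]; first exact: (@in_sorted_word [::]).
apply: (@in_sorted_trans _ _ (\sum_x c x *: wd (i :: val x))).
  have := ideal_mull (gen k i) wc; rewrite mulrBr -word_cons.
  have -> : gen k i * \sum_x c x *: wd (val x) = \sum_x c x *: wd (i :: val x).
    by rewrite mulr_sumr; apply: eq_bigr => x _; rewrite freeAlg_scaleAr -word_cons.
  by [].
elim/big_ind: _ => [|f g|x _]; first exact: in_sorted0.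
  exact: in_sortedD.
by apply/in_sortedZ/in_sorted_cons; [exact: (valP x)|exact: size_tuple].
Qed.

Lemma has_dim_cyc_space_le d m : has_dim cyc_space d m ->
  (m <= #|[pred w : d.-tuple 'I_3 | sorted_word w]|)%N.
Proof.
have -> : #|[pred w : d.-tuple 'I_3 | sorted_word w]| =
    #|{: {w : d.-tuple 'I_3 | sorted_word w}}| by rewrite card_sig.
pose e (x : {w : d.-tuple 'I_3 | sorted_word w}) := wd (val x).
apply: (has_dim_le_span (e := e)) => w.
by have := in_sorted_all w; rewrite size_tuple.
Qed.

(** The relation of index [l] reads [x_l, x_(nxt l)] = x_l^2, and each unordered pair of distinct
    letters occurs for exactly one [l]. *)
Definition cyc_coef (i j l : 'I_3) : k :=
  (((i == l) && (j == nxt l)) || ((i == nxt l) && (j == l)))%:R.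

Lemma span_square_comb n (J : finType) (fam : J -> 'M[k]_n) (b : 'I_n -> 'I_n -> 'I_n -> k) :
    (forall s l, fam s l l + \sum_(i < n) \sum_(j < n | (i < j)%N) fam s i j * b i j l = 0) ->
  forall M, M \in <<[seq fam s | s : J]>>%VS ->
    forall l, M l l + \sum_(i < n) \sum_(j < n | (i < j)%N) M i j * b i j l = 0.
Proof.
move=> fam0 M /(mem_famP (erefl _))[c ->] l.
transitivity (\sum_s c s * (fam s l l +
  \sum_(i < n) \sum_(j < n | (i < j)%N) fam s i j * b i j l)); last first.
  by rewrite big1 // => s _; rewrite fam0 mulr0.
under [RHS]eq_bigr do rewrite mulrDr.
rewrite big_split /= summxE; congr (_ + _); first by apply: eq_bigr => s _; rewrite mxE.
under [RHS]eq_bigr do rewrite mulr_sumr.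
rewrite [RHS]exchange_big; apply: eq_bigr => i _.
under [RHS]eq_bigr do rewrite mulr_sumr.
rewrite [RHS]exchange_big; apply: eq_bigr => j _ /=.
by rewrite summxE mulr_suml; apply: eq_bigr => s _; rewrite mxE mulrA.
Qed.

Lemma sum_offdiag3 (V : nmodType) (F : 'I_3 -> 'I_3 -> V) :
  \sum_(i < 3) \sum_(j < 3 | (i < j)%N) F i j = F p0 p1 + F p0 p2 + F p1 p2.
Proof.
under eq_bigr do rewrite big_mkcond.
have e0 : ord0 = p0 by apply: val_inj.
have e1 : lift ord0 ord0 = p1 by apply: val_inj.
have e2 : lift ord0 (lift ord0 ord0) = p2 by apply: val_inj.
by rewrite !big_ord_recl !big_ord0 e2 e1 e0 /= !(add0r, addr0).
Qed.

Lemma cyc_rel_rel s l :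
  cyc_rel s l l + \sum_(i < 3) \sum_(j < 3 | (i < j)%N) cyc_rel s i j * cyc_coef i j l = 0.
Proof.
rewrite sum_offdiag3; elim/ord3P: s; elim/ord3P: l.
all: by rewrite /cyc_rel /acomm /cyc_coef !mxE /= !(mulr0, mul0r, mulr1, addr0, add0r).
Qed.

Lemma has_dim_cyc_space d : has_dim cyc_space d #|[pred w : d.-tuple 'I_3 | sorted_word w]|.
Proof.
have [m Cm] := has_dim_exists cyc_space d.
suff -> : #|[pred w : d.-tuple 'I_3 | sorted_word w]| = m by [].
apply/eqP; rewrite eqn_leq has_dim_cyc_space_le // andbT.
apply: (has_dim_ge_sorted two0 (b := cyc_coef)) Cm; first exact: sym_cyc_space.
exact: span_square_comb cyc_rel_rel.
Qed.

Lemma cyc_dual_comm : (built_in k Commutative 3 <= koszul_dual cyc_space)%VS.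
Proof. exact/built_in_sub_dual/sym_cyc_space. Qed.

(** Pairing with the all-ones matrix is evaluation at (1, 1, 1); since this matrix lies in
    [cyc_space], the relations of the dual vanish at that point. *)
Lemma sum_cyc_rel a b : (\sum_l cyc_rel l) a b = 1.
Proof.
rewrite summxE !big_ord_recl big_ord0; elim/ord3P: a; elim/ord3P: b.
all: by rewrite /cyc_rel /acomm !mxE /= !(addr0, add0r).
Qed.

(* The point with all coordinates equal to 1 is a common zero of the relations of
   the commutative algebra dual to cyc_space. *)
Lemma has_dim_cyc_dual d m : has_dim (koszul_dual cyc_space) d m -> (0 < m)%N.
Proof.
move=> dm; rewrite -(card1 (nseq_tuple d p0)).
apply: (has_dim_ge_free (V := k^o) (h := fun=> 1)) dm => [u w M /koszul_dualP M0|c].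
  transitivity (pairing (\sum_l cyc_rel l) M); last first.
    apply: M0; apply: memv_suml => l _; exact: (fam_mem (erefl _)).
  rewrite /pairing; apply: eq_bigr => a _; apply: eq_bigr => b _.
  by rewrite -[_ *: _]/(M a b * 1) mulrC sum_cyc_rel.
rewrite big_pred1_eq -[_ *: _]/(c _ * 1) mulr1 => c0 w.
by move=> /eqP->.
Qed.

End CentralSquares.

(** * The generic algebra of Lie type (3, 3) *)

Section GenericLie.
Variable k0 : fieldType.
Local Notation K := (field_of_coef k0 LieType 3 3).
Local Notation indet := (@indet_coef k0 LieType 3 3).

Definition pair3 (e : 'I_3) : 'I_3 * 'I_3 :=
  match val e with 0 => (p0, p1) | 1 => (p0, p2) | _ => (p1, p2) end.

(** Inverting this matrix solves the generic relations for the three [x_i, x_j], [i < j]. *)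
Definition coef_mx : 'M[K]_3 := \matrix_(i, e) indet i (srt (pair3 e)).

(** Specializing the relations to the three [x_i, x_j] turns the matrix into the identity, so its
    generic rank is 3. *)
Lemma coef_mx_unit : coef_mx \in unitmx.
Proof.
pose X : 'M[mpoly (num_coef LieType 3 3) k0]_3 :=
  \matrix_(i, e) 'X_(enum_rank (i, srt (pair3 e) : mon2 LieType 3)).
pose v (x : 'I_(num_coef LieType 3 3)) : k0 :=
  ((enum_val x).2 == srt (pair3 (enum_val x).1))%:R.
have evX : map_mx (mpoly.meval v) X = 1%:M.
  apply/matrixP => i e; rewrite !mxE /= mevalXU /v enum_rankK /=; congr (_%:R).
  by elim/ord3P: i; elim/ord3P: e; rewrite -val_eqE !val_srt.
have -> : coef_mx = map_mx (@FracField.tofrac _) X by apply/matrixP => i e; rewrite !mxE.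
rewrite -row_full_unit /row_full eqn_leq rank_leq_col -{1}(mxrank1 k0 3) -evX.
apply: (@rank_specialize _ _ _ (@mpolyC _ k0)) => [x|x y /eqP]; first exact: mevalC.
by rewrite tofrac_eq => /eqP.
Qed.

(** [B] solves [coef_mx *m B = - D], where [D] holds the coefficients of the squares; its row [e]
    belongs to the pair [pair3 e]. The match is designed for [i < j], so that [0, _] stands for (0,
    2). *)
Definition coefG (i j l : 'I_3) : K :=
  let B := - (invmx coef_mx *m \matrix_(s, l) indet s (srt (l, l))) in
  match val i, val j with 0, 1 => B p0 l | 0, _ => B p1 l | _, _ => B p2 l end.

Lemma coefG_rel s l :
  let M := \sum_p indet s p *: mon2_form K LieType (val p) in
  M l l + \sum_(i < 3) \sum_(j < 3 | (i < j)%N) M i j * coefG i j l = 0.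
Proof.
move=> M; rewrite sum_offdiag3 /M !lie_relE /coefG /=.
set D := \matrix_(s, l) _; set B := - _.
have : (coef_mx *m B + D) s l = 0.
  by rewrite /B mulmxN mulmxA mulmxV ?coef_mx_unit // mul1mx addNr mxE.
rewrite 2!mxE !big_ord_recl big_ord0.
have e0 : ord0 = p0 by apply: val_inj.
have e1 : lift ord0 ord0 = p1 by apply: val_inj.
have e2 : lift ord0 (lift ord0 ord0) = p2 by apply: val_inj.
have coefE e : coef_mx s e = indet s (srt (pair3 e)) by rewrite mxE.
have DE : D s l = indet s (srt (l, l)) by rewrite mxE.
by rewrite e2 e1 e0 !coefE DE addr0 addrA addrC.
Qed.

Lemma has_dim_generic_lie d m : 2%:R = 0 :> k0 ->
  has_dim (generic_rel k0 LieType 3 3) d m ->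
  (#|[pred w : d.-tuple 'I_3 | sorted_word w]| <= m)%N.
Proof.
move=> two0 dm.
have two0K : 2%:R = 0 :> K.
  pose iota : {rmorphism k0 -> K} := @FracField.tofrac _ \o @mpolyC _ k0.
  by rewrite -(rmorph_nat iota) two0 rmorph0.
pose famG s : 'M[K]_3 := \sum_p indet s p *: mon2_form K LieType (val p).
have genE : generic_rel k0 LieType 3 3 = <<[seq famG s | s : 'I_3]>>%VS.
  exact: addv0.
rewrite genE in dm; apply: (has_dim_ge_sorted two0K (b := coefG)) dm.
  move=> M; apply: sym_span => s; apply/matrixP => a b; rewrite mxE !lie_relE.
  congr (indet s _); apply: val_inj; rewrite !val_srt /=.
  by case: ltngtP => // /val_inj->.
by apply: span_square_comb => s l; apply: coefG_rel.
Qed.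

End GenericLie.

(** * The commutative algebra whose relations are the squares of the variables *)

Section Squares.
Variables (k : fieldType) (n : nat).

Definition coef_sqr (i : 'I_n) (p : mon2 Commutative n) : k := (val p == (i, i))%:R.

Lemma sqr_mem i : delta_mx i i \in rel_space coef_sqr.
Proof.
apply: (subvP (addvSl _ _)); apply/memv_span/mapP; exists i; rewrite ?mem_enum //.
have srtE (p : mon2 Commutative n) : coef_sqr i p = (p == srt (i, i))%:R.
  by rewrite /coef_sqr -val_eqE val_srt leqnn.
rewrite (bigD1 (srt (i, i))) // big1 => [|p /negPf pi]; last by rewrite srtE pi scale0r.
by rewrite srtE eqxx scale1r val_srt leqnn [RHS]addr0.
Qed.

(** A word longer than [n] repeats a letter; commutativity brings two occurrences to the front,
    where their square is a relation. *)
Lemma has_dim_sqr d m : (n < d)%N -> has_dim (rel_space coef_sqr) d m -> m = 0%N.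
Proof.
move=> nd /(@has_dim_le_span _ _ _ _ _ _ (fun i : 'I_0 => 0)).
rewrite card_ord leqn0 => h; apply/eqP/h => w; exists (fun=> 0).
rewrite big_ord0 subr0.
have : ~~ uniq w.
  apply: contraL nd => /card_uniqP; rewrite size_tuple -leqNgt => <-.
  by rewrite -[X in (_ <= X)%N]card_ord max_card.
have [i w2 _|w1] := pickP (fun i => 1 < count_mem i w)%N; last first.
  case/negP; apply: count_mem_uniq => i; have := w1 i.
  by rewrite -has_pred1 has_count; case: (count_mem i w) => [|[]].
have iw : i \in w by rewrite -has_pred1 has_count ltnW.
have iw' : i \in rem i w.
  rewrite -has_pred1 has_count count_rem iw /= eqxx.
  by move: w2; case: (count_mem i w) => [|[]].
have wE : perm_eq w [:: i, i & rem i (rem i w)].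
  by apply: perm_trans (perm_to_rem iw) _; rewrite perm_cons perm_to_rem.
rewrite -(subrK (word k [:: i, i & rem i (rem i w)]) (word k w)).
apply: idealD.
  by apply: ideal_perm wE; apply: addvSr.
exact: (ideal_word0_cat [::] (rem i (rem i w)) (ideal_delta2 (sqr_mem i))).
Qed.

End Squares.

(** * The theorem *)

Lemma two0_big_field N : 2%:R = 0 :> big_field 'F_2 N.
Proof. by rewrite -(rmorph_nat (big_field_inj 'F_2 N)) (_ : 2%:R = 0) ?rmorph0 //;
  apply/val_inj. Qed.

Lemma two0_F2 : 2%:R = 0 :> 'F_2.
Proof. exact/val_inj. Qed.

(** Equal series would give the generic algebra dimension at least 81 in degree 4, while
    semicontinuity at the tensor product bounds it by 80. *)
Lemma not_generic_syz_space (k : fieldType) C : 2%:R = 0 :> k ->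
  of_type C 4 (tensor_space 'F_2) -> ~ generic 'F_2 C 4 (syz_space k).
Proof.
move=> two0 [c [_ TE]] [_ /(_ 4)[m [Lm gm]]].
have [m0 Tm] := has_dim_exists (tensor_space 'F_2) 4.
have mm0 : (m <= m0)%N by move: (Tm); rewrite TE; apply: has_dim_specialize gm.
have := leq_trans (dim4_syz_space two0 Lm) (leq_trans mm0 (dim4_tensor_space two0_F2 Tm)).
by [].
Qed.

Theorem theorem4p2 :
  (exists (k0 k : fieldType) (iota : {rmorphism k0 -> k}) (n r : nat)
      (U : {vspace 'M[k]_n}),
    nongeneric_dual iota Commutative LieType r ('C(n.+1, 2) - r)%N U) /\
  (exists (k0 k : fieldType) (iota : {rmorphism k0 -> k}) (n r : nat)
      (U : {vspace 'M[k]_n}),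
    nongeneric_dual iota NonCommutative NonCommutative r (n ^ 2 - r)%N U) /\
  (exists (k0 k : fieldType) (iota : {rmorphism k0 -> k}) (n r : nat)
      (U : {vspace 'M[k]_n}),
    nongeneric_dual iota LieType Commutative r ('C(n.+1, 2) - r)%N U).
Proof.
split; [|split].
(* The sum of the two numbers of coefficients meets both bounds on the transcendence degree. *)
- pose N := (num_coef Commutative 4 6 + num_coef LieType 4 4)%N.
  exists 'F_2, (big_field 'F_2 N), (big_field_inj 'F_2 N), 4%N, 6%N, (syz_dual _).
  split.
  + exact: Fp_prime_field.
  + by split; apply: trdeg_big_field; [apply: leq_addr|apply: leq_addl].
  (* The dimension 12 of [syz_dual] counts 6 relations and 6 commutators. *)
  + apply: (generic_short (syz_dual_comm_type 'F_2) (syz_dual_comm_type _));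
    rewrite ?dim_syz_dual //.
      exact: syz_dual_word3.
    exact: syz_dual_word3.
  + by rewrite syz_dualK; apply: syz_space_lie_type.
  rewrite syz_dualK; apply: not_generic_syz_space; first exact: two0_big_field.
  by have := of_type_lie (@sym_tensor_space 'F_2); rewrite dim_tensor_space.
- pose N := (num_coef NonCommutative 4 12 + num_coef NonCommutative 4 4)%N.
  exists 'F_2, (big_field 'F_2 N), (big_field_inj 'F_2 N), 4%N, 12%N, (syz_dual _).
  split.
  + exact: Fp_prime_field.
  + by split; apply: trdeg_big_field; [apply: leq_addr|apply: leq_addl].
  + apply: (generic_short (syz_dual_noncomm_type 'F_2) (syz_dual_noncomm_type _));
    rewrite ?dim_syz_dual //.
      exact: syz_dual_word3.
    exact: syz_dual_word3.
  + by rewrite syz_dualK; apply: syz_space_noncomm_type.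
  rewrite syz_dualK; apply: not_generic_syz_space; first exact: two0_big_field.
  by have := of_type_noncomm (tensor_space 'F_2); rewrite dim_tensor_space.
pose N := (num_coef LieType 3 3 + num_coef Commutative 3 3)%N.
exists 'F_2, (big_field 'F_2 N), (big_field_inj 'F_2 N), 3%N, 3%N, (cyc_space _).
have typeC (k : fieldType) : of_type LieType 3 (cyc_space k).
  by have := of_type_lie (@sym_cyc_space k); rewrite dim_cyc_space.
split.
- exact: Fp_prime_field.
- by split; apply: trdeg_big_field; [apply: leq_addr|apply: leq_addl].
(* The generic dimension is bounded above by semicontinuity at the same relations over ['F_2], and
   below by the differential operators. *)
- split=> // d; have Cd := has_dim_cyc_space (two0_big_field N) d.
  exists #|[pred w : d.-tuple 'I_3 | sorted_word w]|; split=> //.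
  have [m gm] := has_dim_exists (generic_rel 'F_2 LieType 3 3) d.
  have mC : (m <= #|[pred w : d.-tuple 'I_3 | sorted_word w]|)%N.
    have [c [_ CE]] := typeC 'F_2.
    by have := has_dim_cyc_space two0_F2 d; rewrite CE; apply: has_dim_specialize gm.
  rewrite (_ : #|_| = m) //; apply/eqP.
  by rewrite eqn_leq mC (has_dim_generic_lie two0_F2 gm).
(* The dual has dimension 9 - 3 = 6, of which 3 are commutators; this leaves the 3 relations
   required. *)
- have := of_type_comm (cyc_dual_comm (big_field 'F_2 N)).
  by have := dim_koszul_dual (cyc_space (big_field 'F_2 N));
    rewrite dim_cyc_space => /(@addIn 3 _ 6) ->.
(* Degree 4 exceeds the number of variables, so specializing to the squares makes the generic
   component zero. *)
case=> _ /(_ 4)[m [Cm gm]].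
have [m0 sm0] := has_dim_exists (rel_space (@coef_sqr 'F_2 3)) 4.
have := has_dim_specialize gm sm0; rewrite (has_dim_sqr _ sm0) // leqn0.
by apply/negP; rewrite -lt0n; apply: has_dim_cyc_dual Cm.
Qed.
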